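(* Any real-number RAM that supports direct assignments, memory access, flow control, and the arithmetic instructions $\{+,-,\times,/\}$ takes $\Omega(n\log n)$ time in the worst case to solve the single maximum coverage location problem on a tree with $n$ nodes, even when all penalties equal $1$ and all radii are equal.
   Context: Single maximum coverage location problem on a tree: the input is a tree $T=(V,E)$ with non-negative real edge lengths inducing the path distance $d$, and for each node $u$ a non-negative penalty $\pi(u)$ and a radius $\rho(u)$. For a node $y$, node $u$ imposes penalty $\pi(u)$ on $y$ if $d(u,y)>\rho(u)$ and $0$ otherwise. The goal is to find a node $y$ minimizing the total penalty $\sum_{u\in V}$ (penalty imposed by $u$ on $y$). *)

(* Defs.v *)
(* MathComp + MathComp-Analysis. *)
From mathcomp Require Import all_boot all_order all_algebra.
From mathcomp Require Import reals exp.

Set Implicit Arguments.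
Unset Strict Implicit.
Unset Printing Implicit Defensive.

Import Order.TTheory GRing.Theory Num.Theory.

Local Open Scope ring_scope.

(** * Single maximum coverage location on a tree *)

(* Trees are nonempty; without 0 < n an instance with no node to output
   would make every machine incorrect. *)
Definition is_tree (n : nat) (adj : rel 'I_n) : Prop :=
  [/\ (0 < n)%N,
      symmetric adj,
      irreflexive adj,
      forall u v, connect adj u v
    & forall c : seq 'I_n, ucycle adj c -> (size c <= 2)%N].

(* [len u v] is the length of the edge uv; it is meaningless, and never
   inspected, when u and v are not adjacent. *)
Record instance (R : realType) (n : nat) := Instance {
  adj : rel 'I_n;
  len : 'I_n -> 'I_n -> R;
  pen : 'I_n -> R;
  rad : 'I_n -> R;
  adj_tree : is_tree adj;
  len_sym : forall u v, adj u v -> len u v = len v u;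
  len_ge0 : forall u v, adj u v -> 0 <= len u v;
  pen_ge0 : forall u, 0 <= pen u;
  rad_ge0 : forall u, 0 <= rad u
}.

Section Problem.
Variables (R : realType) (n : nat) (I : instance R n).

(* The simple path from u to v, without its first node u; in a tree exactly
   one sequence satisfies the condition, and it has fewer than n elements. *)
Definition tree_path (u v : 'I_n) : seq 'I_n :=
  if [pick p : {bseq n of 'I_n} |
        [&& path (adj I) u p, last u p == v & uniq (u :: p)]] is Some p
  then p else [::].

Definition dist (u v : 'I_n) : R :=
  let p := tree_path u v in \sum_(e <- zip (u :: p) p) len I e.1 e.2.

Definition imposed (u y : 'I_n) : R :=
  if rad I u < dist u y then pen I u else 0.

Definition total_penalty (y : 'I_n) : R := \sum_(u < n) imposed u y.

Definition is_solution (y : 'I_n) : Prop :=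
  forall z, total_penalty y <= total_penalty z.

Definition unit_penalties : Prop := forall u, pen I u = 1.

Definition equal_radii : Prop := forall u v, rad I u = rad I v.

(* The n-1 edges, each listed once, in lexicographic order. *)
Definition edge_list : seq ('I_n * 'I_n) :=
  enum [pred e : 'I_n * 'I_n | (e.1 < e.2)%N && adj I e.1 e.2].

(* Input layout: n, then a triple (u, v, length) per edge, then the n
   penalties, then the n radii.  Node u is denoted by the number u < n. *)
Definition encode : seq R :=
  n%:R :: flatten [seq [:: (val e.1)%:R; (val e.2)%:R; len I e.1 e.2]
                  | e : 'I_n * 'I_n <- edge_list]
       ++ [seq pen I u | u <- enum 'I_n]
       ++ [seq rad I u | u <- enum 'I_n].

End Problem.

(** * Real-number RAM *)

(* Registers are addressed directly by the program; memory is addressed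
   indirectly, through a register holding the address. *)
Variant arith_op := Add | Sub | Mul | Div.
Variant cmp_op := CmpLt | CmpLe | CmpEq.

Variant instr (R : realType) :=
  | Const (i : nat) (c : R)                (* r_i <- c *)
  | Move (i j : nat)                       (* r_i <- r_j *)
  | Read (i j : nat)                       (* r_i <- mem[r_j] *)
  | Write (i j : nat)                      (* mem[r_i] <- r_j *)
  | Arith (o : arith_op) (i j k : nat)     (* r_i <- r_j o r_k *)
  | Jump (l : nat)                         (* goto l *)
  | Branch (o : cmp_op) (i j l : nat)  (* if r_i o r_j then goto l *)
  | Halt.

Arguments Move {R}.
Arguments Read {R}.
Arguments Write {R}.
Arguments Arith {R}.
Arguments Jump {R}.
Arguments Branch {R}.
Arguments Halt {R}.

Definition program (R : realType) := seq (instr R).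

Record config (R : realType) := Config {
  pc : nat;
  reg : nat -> R;
  memory : nat -> R
}.

Section Machine.
Variable R : realType.
Implicit Types (P : program R) (c : config R) (f : nat -> R).

Definition update f (a : nat) (x : R) : nat -> R :=
  fun b => if b == a then x else f b.

(* Only natural numbers are addresses; using any other real as an address is
   an error (rounding it would amount to a floor instruction). *)
Definition address (x : R) : option nat :=
  if x \is a Num.nat then Some (Num.truncn x) else None.

(* Division by zero is an error. *)
Definition eval_op (o : arith_op) (x y : R) : option R :=
  match o with
  | Add => Some (x + y)
  | Sub => Some (x - y)
  | Mul => Some (x * y)
  | Div => if y == 0 then None else Some (x / y)
  end.

Definition eval_cmp (o : cmp_op) (x y : R) : bool :=
  match o with
  | CmpLt => x < y
  | CmpLe => x <= y
  | CmpEq => x == y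
  end.

(* Running past the end of the program halts. *)
Definition current P c : instr R := nth Halt P (pc c).

Definition halted P c : bool := if current P c is Halt then true else false.

(* [None] when the machine has halted or when the instruction is an error. *)
Definition step P c : option (config R) :=
  let: Config l r m := c in
  match current P c with
  | Const i x => Some (Config l.+1 (update r i x) m)
  | Move i j => Some (Config l.+1 (update r i (r j)) m)
  | Read i j =>
      if address (r j) is Some a
      then Some (Config l.+1 (update r i (m a)) m) else None
  | Write i j =>
      if address (r i) is Some a
      then Some (Config l.+1 r (update m a (r j))) else None
  | Arith o i j k =>
      if eval_op o (r j) (r k) is Some x
      then Some (Config l.+1 (update r i x) m) else None
  | Jump l' => Some (Config l' r m)
  | Branch o i j l' =>
      Some (Config (if eval_cmp o (r i) (r j) then l' else l.+1) r m)
  | Halt => None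
  end.

Definition run P (t : nat) c : option (config R) :=
  iter t (fun oc => obind (step P) oc) (Some c).

(* Every instruction takes unit time. *)
Definition halts_in P (c : config R) (t : nat) (c' : config R) : Prop :=
  run P t c = Some c' /\ halted P c'.

Definition initial (input : seq R) : config R :=
  Config 0 (fun _ => 0) (fun a => nth 0 input a).

(* On input I, P halts after t instructions with an optimal node in r_0. *)
Definition solves_in P (n : nat) (I : instance R n) (t : nat) : Prop :=
  exists (c : config R) (y : 'I_n),
    [/\ halts_in P (initial (encode I)) t c,
        reg c 0%N = (y : nat)%:R
      & is_solution I y].

End Machine.

(* Main.v *)
Require Import Defs.
From mathcomp Require Import all_boot all_order all_algebra.
From mathcomp Require Import boolp classical_sets reals topology normedtype.
From mathcomp Require Import sequences derive exp.
From mathcomp Require Import zify ring lra.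

(* The hard instances are double brooms: parameters s_1, ..., s_k in [1, m] enter
   the lengths of the leaves at both ends of a path 0, ..., m in such a way that
   node 0 is optimal iff no s_c is an integer.  The (m - 1)^k unit cubes of the
   integer grid are thus pairwise separated by inputs with another answer.

   Along a fixed sequence of branch outcomes the machine computes quotients of
   polynomials in s, and at most 2^T sequences occur in time T.  Let g be the
   product of the (signed) tests on one of them.  On every cube met by this
   sequence, g has a positive value but vanishes on the boundary of the region
   where the tests succeed, so g and all its small perturbations have an interior
   local maximum there.  As g is obtained by O(T) multiplications, these
   maxima solve a system of M = O(k + T) quadratic equations in M unknowns, the
   unknowns being s, the intermediate products and Lagrange multipliers.

   The number N of solutions is bounded without Bezout's theorem or any
   genericity.  The right-hand side w of the system may be perturbed arbitrarily,
   with N solutions for each small w.  The N^(M + 1) solutions above a grid of N^M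
   values of w are separated by polynomials of degree at most 3MN in M variables,
   whence N^(M + 1) <= C(3MN, M) and N <= 12^M.  So (m - 1)^k <= 2^T 12^O(k + T),
   and k and m may be taken linear in n. *)

Set Implicit Arguments.
Unset Strict Implicit.
Unset Printing Implicit Defensive.

Import Order.TTheory GRing.Theory Num.Theory.
Import numFieldNormedType.Exports.

Local Open Scope ring_scope.

(** * Preimages under quadratic maps *)

Section DegreeBounded.
Variables (R : realType) (M : nat).
Implicit Types (u : 'rV[R]_M) (f g : 'rV[R]_M -> R).

(* Functions of degree at most d are forms of degree d in the coordinates of (1, u). *)
Definition homog u (i : 'I_M.+1) : R := if unlift ord0 i is Some j then u 0 j else 1.

Definition monomial (s : seq 'I_M.+1) u : R := \prod_(i <- s) homog u i.

Definition deg_le (d : nat) f : Prop :=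
  exists c : {ffun d.-tuple 'I_M.+1 -> R}, forall u, f u = \sum_t c t * monomial t u.

Lemma deg_leD d f g : deg_le d f -> deg_le d g -> deg_le d (fun u => f u + g u).
Proof.
move=> [c cP] [e eP]; exists [ffun t => c t + e t] => u.
by rewrite cP eP -big_split; apply: eq_bigr => t _; rewrite ffunE mulrDl.
Qed.

Lemma deg_leZ d a f : deg_le d f -> deg_le d (fun u => a * f u).
Proof.
move=> [c cP]; exists [ffun t => a * c t] => u.
by rewrite cP big_distrr /=; apply: eq_bigr => t _; rewrite ffunE mulrA.
Qed.

Lemma deg_leM d e f g : deg_le d f -> deg_le e g -> deg_le (d + e) (fun u => f u * g u).
Proof.
move=> [c cP] [b bP].
exists [ffun t => \sum_(p : d.-tuple 'I_M.+1 * e.-tuple 'I_M.+1 | cat_tuple p.1 p.2 == t)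
   c p.1 * b p.2] => u.
under eq_bigr do rewrite ffunE big_distrl /=.
rewrite (exchange_big_dep xpredT) //= cP bP big_distrlr /=.
rewrite pair_big /=; apply: eq_bigr => -[p q] _ /=.
rewrite (big_pred1 (cat_tuple p q)) => [|t]; last by rewrite /= eq_sym.
by rewrite /monomial /= big_cat /= mulrACA.
Qed.

Lemma deg_le_monomial s : deg_le (size s) (monomial s).
Proof.
exists [ffun t => (t == in_tuple s)%:R] => u.
rewrite (bigD1 (in_tuple s)) //= big1 ?addr0 ?ffunE ?eqxx ?mul1r // => t /negPf nt.
by rewrite ffunE nt mul0r.
Qed.

Lemma deg_le_eq d f g : f =1 g -> deg_le d f -> deg_le d g.
Proof. by move=> fg [c cP]; exists c => u; rewrite -fg cP. Qed.

Lemma deg_le_one d : deg_le d (fun=> 1).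
Proof.
have := deg_le_monomial (nseq d ord0); rewrite size_nseq; apply: deg_le_eq => u.
rewrite /monomial big_seq big1 // => i /nseqP[-> _].
by rewrite /homog unlift_none.
Qed.

Lemma deg_le_cst d a : deg_le d (fun=> a).
Proof. by apply: deg_le_eq (deg_leZ a (deg_le_one d)) => u; rewrite mulr1. Qed.

Lemma deg_le_leq d e f : (d <= e)%N -> deg_le d f -> deg_le e f.
Proof.
move=> /subnKC <- df.
by apply: deg_le_eq (deg_leM df (deg_le_one _)) => u; rewrite mulr1.
Qed.

Lemma deg_le_coord i : deg_le 1 (fun u => u 0 i).
Proof.
apply: deg_le_eq (deg_le_monomial [:: lift ord0 i]) => u.
by rewrite /monomial big_seq1 /homog liftK.
Qed.

Lemma deg_le_sum d (I : Type) (r : seq I) (P : pred I) (F : I -> 'rV[R]_M -> R) :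
  (forall i, P i -> deg_le d (F i)) -> deg_le d (fun u => \sum_(i <- r | P i) F i u).
Proof.
move=> dF; elim: r => [|i r IH].
  by apply: deg_le_eq (deg_le_cst d 0) => u; rewrite big_nil.
case Pi: (P i); last by apply: deg_le_eq IH => u; rewrite big_cons Pi.
by apply: deg_le_eq (deg_leD (dF _ Pi) IH) => u; rewrite big_cons Pi.
Qed.

Lemma deg_le_prod d (I : finType) (P : pred I) (F : I -> 'rV[R]_M -> R) :
  (forall i, P i -> deg_le d (F i)) ->
  deg_le (\sum_(i | P i) d) (fun u => \prod_(i | P i) F i u).
Proof.
move=> dF; elim: (index_enum I) => [|i r IH].
  by rewrite big_nil; apply: deg_le_eq (deg_le_one 0) => u; rewrite big_nil.
rewrite big_cons; case Pi: (P i); last by apply: deg_le_eq IH => u; rewrite big_cons Pi.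
by apply: deg_le_eq (deg_leM (dF _ Pi) IH) => u; rewrite big_cons Pi.
Qed.

(* A function of degree at most d is a combination of the monomials indexed by
   sorted tuples, of which there are C(d + M, d); the matrix of the values of
   the f a at the points p b factors through them. *)
Lemma separated_card (K : finType) d (f : K -> 'rV[R]_M -> R) (p : K -> 'rV[R]_M) :
  (forall a, deg_le d (f a)) -> (forall a, f a (p a) != 0) ->
  (forall a b, a != b -> f a (p b) = 0) -> (#|K| <= 'C(d + M, d))%N.
Proof.
move=> df f_neq0 f_eq0.
pose S := [set t : d.-tuple 'I_M.+1 | sorted leq (map val t)].
pose srt (t : d.-tuple 'I_M.+1) := sort_tuple (fun i j : 'I_M.+1 => i <= j)%N t.
have srtS t : srt t \in S.
  rewrite inE /srt /= sorted_map; apply: sort_sorted => i j; exact: leq_total.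
have mon_srt t u : monomial (srt t) u = monomial t u.
  by apply: perm_big; rewrite perm_sort.
have [c cP] := @choice _ _ _ df.
rewrite -card_sorted_tuples -/S.
pose A : 'M[R]_(#|K|, #|S|) :=
  \matrix_(i, j) \sum_(t | srt t == enum_val j) c (enum_val i) t.
pose B : 'M[R]_(#|S|, #|K|) := \matrix_(j, i) monomial (enum_val j : d.-tuple _) (p (enum_val i)).
have AB : A *m B = diag_mx (\row_i f (enum_val i) (p (enum_val i))).
  apply/matrixP => i j; rewrite !mxE.
  transitivity (f (enum_val i) (p (enum_val j))).
    rewrite cP [RHS](partition_big srt (fun t => t \in S)) //= [RHS]big_enum_val.
    apply: eq_bigr => l _; rewrite !mxE big_distrl /=.
    by apply: eq_bigr => t /eqP <-; rewrite mon_srt.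
  case: (eqVneq i j) => [->|ij]; first by rewrite mulr1n.
  by rewrite mulr0n f_eq0 // (inj_eq enum_val_inj).
have: \rank (A *m B) = #|K|.
  apply/eqP; rewrite -/(row_free _) row_free_unit unitmxE AB det_diag unitfE.
  by apply/prodf_neq0 => i _; rewrite mxE.
by move=> <-; apply: leq_trans (mxrankM_maxl _ _) (rank_leq_col _).
Qed.

End DegreeBounded.

(** * Counting the preimages of a quadratic map over a cube of values *)

Section QuadraticCount.
Variables (R : realType) (M N : nat).
Hypotheses (M_gt0 : (0 < M)%N) (N_gt0 : (0 < N)%N).
Variable F : 'I_M -> 'rV[R]_M -> R.
Hypothesis F_quad : forall l, deg_le 2 (F l).
Variable delta : R.
Hypothesis delta_gt0 : 0 < delta.
Hypothesis preim : forall w : 'I_M -> R, (forall l, 0 <= w l <= delta) ->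
  exists u : 'I_N -> 'rV[R]_M, injective u /\ forall i l, F l (u i) = w l.

(* Above each of the N ^ M points of a grid lie N preimages; a product of grid
   indicators in the F l with separating affine forms singles out each of them,
   with total degree linear in N. *)
Lemma quadratic_preimages_binomial :
  (N ^ M * N <= 'C((M * N.-1 * 2 + N.-1) + M, M * N.-1 * 2 + N.-1))%N.
Proof.
pose grid (x : 'I_N) : R := delta / N%:R * (x : nat)%:R.
have N_gt0R : 0 < N%:R :> R by rewrite ltr0n.
have grid_inj : injective grid.
  move=> x y /(mulfI (_ : delta / N%:R != 0)) h; apply/val_inj/eqP.
  by rewrite -(eqr_nat R) h // mulf_neq0 ?invr_eq0 ?gt_eqF.
have grid_le x : 0 <= grid x <= delta.
  apply/andP; split; first by rewrite /grid !mulr_ge0 ?ler0n ?invr_ge0 ?ltW.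
  rewrite /grid -mulrA ler_piMr ?(ltW delta_gt0) //.
  by rewrite mulrC ler_pdivrMr // mul1r ler_nat ltnW.
have /choice[U UP] : forall w : {ffun 'I_M -> 'I_N}, exists u : 'I_N -> 'rV[R]_M,
    injective u /\ forall i l, F l (u i) = grid (w l).
  by move=> w; apply: (preim (w := fun l => grid (w l))) => l; exact: grid_le.
(* [c] selects a coordinate in which two distinct preimages of the same grid point differ; it yields
   the affine form that separates them. *)
have /choice[c cP] : forall a : {ffun 'I_M -> 'I_N} * 'I_N * 'I_N, exists l,
    a.1.2 != a.2 -> U a.1.1 a.1.2 0 l != U a.1.1 a.2 0 l.
  move=> [[w i] j] /=.
  case: (pickP (fun l => U w i 0 l != U w j 0 l)) => [l lP|e]; first by exists l.
  exists (Ordinal M_gt0) => /eqP[]; apply: (UP w).1; apply/rowP => l.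
  by apply/eqP; rewrite -[_ == _]negbK e.
pose f (a : {ffun 'I_M -> 'I_N} * 'I_N) u :=
  (\prod_(l : 'I_M) \prod_(x | x != a.1 l) (F l u - grid x)) *
  \prod_(j | j != a.2) (u 0 (c (a, j)) - U a.1 j 0 (c (a, j))).
have cardN (y : 'I_N) : (\sum_(x | x != y) 1 = N.-1)%N.
  by rewrite sum1_card (cardC1 y) card_ord.
have -> : (N ^ M * N = #|{: {ffun 'I_M -> 'I_N} * 'I_N}|)%N.
  by rewrite card_prod card_ffun !card_ord.
apply: (@separated_card R _ _ _ f (fun a => U a.1 a.2)) => [[w i]|[w i]|[w i] [v j] wv].
- apply: deg_leM.
    apply: (@deg_le_leq _ _ (\sum_(l : 'I_M) N.-1 * 2)%N).
      by rewrite sum_nat_const card_ord mulnA.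
    apply: deg_le_prod => l _.
    apply: (@deg_le_leq _ _ (\sum_(x | x != w l) 2)%N).
      by rewrite -[X in (_ <= X * _)%N](cardN (w l)) big_distrl.
    apply: deg_le_prod => x _; apply: deg_leD => //; exact: deg_le_cst.
  apply: (@deg_le_leq _ _ (\sum_(x | x != i) 1)%N); first by rewrite cardN.
  apply: deg_le_prod => x _; apply: deg_leD; [exact: deg_le_coord|exact: deg_le_cst].
- rewrite /f /= mulf_neq0 //.
    apply/prodf_neq0 => l _; apply/prodf_neq0 => x xw.
    by rewrite (UP w).2 subr_eq0 (inj_eq grid_inj) eq_sym.
  by apply/prodf_neq0 => j ji; rewrite subr_eq0 (cP (w, i, j)) // eq_sym.
rewrite /f /=; case: (eqVneq w v) => [ewv|].
  subst v; rewrite [X in _ * X](bigD1 j) /= ?subrr ?mul0r ?mulr0 //.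
  by apply: contraNneq wv => ->.
move=> nwv; have [l lP] : exists l, w l != v l.
  apply/existsP; apply: contraR nwv; rewrite negb_exists => /forallP e.
  by apply/eqP/ffunP => l; apply/eqP; rewrite -[_ == _]negbK.
by rewrite (bigD1 l) //= (bigD1 (v l)) 1?eq_sym //= (UP v).2 subrr !mul0r.
Qed.

(** With D + M <= 3MN the binomial coefficient is at most (3MN)^M / M!, so N * M! <= (3M)^M; the
    rest is the estimate M^M <= 4^M * M!. *)
Lemma quadratic_preimages_bound : (N <= 12 ^ M)%N.
Proof.
have := quadratic_preimages_binomial; set D := (_ + N.-1)%N => H.
have {}H : (N ^ M * N * M`! <= (3 * M * N) ^ M)%N.
  apply: leq_trans (leq_mul H (leqnn _)) _.
  have -> : 'C(D + M, D) = 'C(D + M, M) by rewrite -(@bin_sub (D + M) M) ?leq_addl // addnK.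
  rewrite bin_ffact.
  have DM : (D + M <= 3 * M * N)%N by rewrite /D; case: (N) N_gt0 => // n _ /=; nia.
  apply: leq_trans (_ : (D + M) ^ M <= _)%N; last by rewrite leq_exp2r.
  rewrite -[X in (_ <= _ ^ X)%N]card_ord -prod_nat_const ffact_prod.
  by apply: leq_prod => i _; exact: leq_subr.
have {}H : (N * M`! <= (3 * M) ^ M)%N.
  rewrite -(@leq_pmul2l (N ^ M)) ?expn_gt0 ?N_gt0 // mulnA.
  by apply: leq_trans H _; rewrite expnMn mulnC.
(* Each of the M factors of (2M)(2M - 1)...(M + 1) = C(2M, M) * M! is at least M, and C(2M, M) <=
   2^(2M). *)
have MM : (M ^ M <= 4 ^ M * M`!)%N.
  have -> : (4 ^ M = 2 ^ (M + M))%N by rewrite addnn -mul2n expnM.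
  have h : ('C(M + M, M) <= 2 ^ (M + M))%N.
    have -> : (2 ^ (M + M) = (1 + 1) ^ (M + M))%N by [].
    rewrite expnDn (bigD1 (inord M : 'I_(M+M).+1)) //= inordK ?ltnS ?leq_addl //.
    by rewrite !exp1n !muln1; apply: leq_addr.
  apply: leq_trans (leq_mul h (leqnn _)).
  rewrite bin_ffact -[X in (_ ^ X <= _)%N]card_ord -prod_nat_const ffact_prod.
  by apply: leq_prod => i _; have := ltn_ord i; lia.
rewrite -(@leq_pmul2r M`!) ?fact_gt0 //; apply: leq_trans H _.
rewrite expnMn; apply: leq_trans (leq_mul (leqnn _) MM) _.
by rewrite mulnA -expnMn.
Qed.

End QuadraticCount.

(** * Lagrange systems of arithmetic circuits *)

Local Open Scope classical_set_scope.

Section TriangularSystem.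
Variables (C : Type) (I : finType) (rk : I -> nat) (T : (I -> C) -> I -> C).
Hypothesis T_tri : forall y z j,
  (forall l, (rk l < rk j)%N -> y l = z l) -> T y j = T z j.

(** Entries are corrected rank by rank, since [T] looks only at smaller ranks. This serves twice:
    forwards for the products of a circuit, backwards for the multipliers. *)
Lemma triangular_solution (z0 : I -> C) : exists z, forall j, z j = T z j.
Proof.
suff H t : exists z, forall j, (rk j < t)%N -> z j = T z j.
  have [z zP] := H (\max_j rk j).+1; exists z => j.
  by apply: zP; rewrite ltnS; exact: leq_bigmax.
elim: t => [|t [z zP]]; first by exists z0.
exists (fun j => if rk j == t then T z j else z j) => j; rewrite ltnS leq_eqVlt => jt.
have -> : T (fun j => if rk j == t then T z j else z j) j = T z j.
  by apply: T_tri => l lj; case: eqP => // lt; move: lj jt; rewrite lt; lia.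
by case: eqP jt => //= _ /zP.
Qed.

Lemma triangular_unique y z :
  (forall j, y j = T y j) -> (forall j, z j = T z j) -> y =1 z.
Proof.
move=> yP zP j; have [n] := ubnP (rk j); elim: n j => // n IH j jn.
by rewrite yP zP; apply: T_tri => l lj; apply: IH; lia.
Qed.

End TriangularSystem.

Lemma horner_local_max_deriv (R : realType) (p : {poly R}) (e : R) :
  0 < e -> (forall t, `|t| < e -> p.[t] <= p.[0]) -> p^`().[0] = 0.
Proof.
move=> e0 pmax.
have H : is_derive (0 : R) 1 (horner p) 0.
  apply: (@derive1_at_max _ (horner p) (- e) e 0); first by lra.
  - by move=> t _; exact: derivable_horner.
  - by rewrite in_itv /=; lra.
  by move=> t; rewrite in_itv /= => /andP[h1 h2]; apply: pmax; rewrite ltr_norml h1.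
by have := @derive_val _ _ _ _ _ _ _ H; rewrite -derive1E -derivE.
Qed.

(** * Functions that depend uniformly on a small perturbation *)

Section Tame.
Variables (R : realType) (k M : nat) (r : R).
Implicit Types (w : 'I_M -> R) (s : 'rV[R]_k) (f g : ('I_M -> R) -> 'rV[R]_k -> R).

(** One constant serves the whole box of radius [r]: a perturbation of size [d] moves the function
    by at most [C * d] at every point of it. *)
Definition tame f : Prop :=
  (forall w, continuous (f w)) /\
  exists2 C, 0 <= C & forall d w s, 0 <= d <= 1 -> (forall i, 0 <= w i <= d) ->
    (forall i, `|s 0 i| <= r) -> `|f w s| <= C /\ `|f w s - f (fun=> 0) s| <= C * d.

Lemma tame_eq f g : (forall w s, f w s = g w s) -> tame f -> tame g.
Proof. by move=> fg; have -> : g = f by apply/funext => w; apply/funext => s. Qed.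

Lemma tame_cst c : tame (fun _ _ => c).
Proof.
split=> [w s|]; first exact: cst_continuous.
exists `|c| => // d w s /andP[d0 _] _ _; split=> //.
by rewrite subrr normr0 mulr_ge0.
Qed.

Lemma tame_coord i : 0 <= r -> tame (fun _ s => s 0 i).
Proof.
move=> r0; split=> [w s|]; first exact: (@coord_continuous R 1 k 0 i).
exists r => // d w s /andP[d0 _] _ sr; split=> //.
by rewrite subrr normr0 mulr_ge0.
Qed.

Lemma tame_param i : tame (fun w _ => w i).
Proof.
split=> [w s|]; first exact: cst_continuous.
exists 1 => // d w s /andP[d0 d1] wd _; rewrite subr0 mul1r.
have /andP[w0 wi] := wd i; rewrite ger0_norm //; split=> //; exact: le_trans wi d1.
Qed.

Lemma tameD f g : tame f -> tame g -> tame (fun w s => f w s + g w s).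
Proof.
move=> [cf [C C0 fC]] [cg [D D0 gD]]; split=> [w s|].
  exact: (continuousD (cf w s) (cg w s)).
exists (C + D); first exact: addr_ge0.
move=> d w s d01 wd sr; have [h1 h2] := fC d w s d01 wd sr.
have [h3 h4] := gD d w s d01 wd sr; split.
  by apply: le_trans (ler_normD _ _) _; exact: lerD.
rewrite opprD addrACA mulrDl; apply: le_trans (ler_normD _ _) _; exact: lerD.
Qed.

Lemma tameM f g : tame f -> tame g -> tame (fun w s => f w s * g w s).
Proof.
move=> [cf [C C0 fC]] [cg [D D0 gD]]; split=> [w s|].
  exact: (continuousM (cf w s) (cg w s)).
have CD : 0 <= C * D by exact: mulr_ge0.
exists (C * D + C * D); first exact: addr_ge0.
move=> d w s d01 wd sr; have [h1 h2] := fC d w s d01 wd sr.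
have [h3 h4] := gD d w s d01 wd sr.
(* The null perturbation gives the bound [D] for the unperturbed [g]. *)
have [h5 _] := gD 0 (fun=> 0) s (introT andP (conj (lexx 0) ler01))
  (fun=> introT andP (conj (lexx 0) (lexx 0))) sr.
split.
  by rewrite normrM; apply: le_trans (ler_pM _ _ h1 h3) _ => //; rewrite lerDl.
have -> : f w s * g w s - f (fun=> 0) s * g (fun=> 0) s =
  f w s * (g w s - g (fun=> 0) s) + (f w s - f (fun=> 0) s) * g (fun=> 0) s by ring.
apply: le_trans (ler_normD _ _) _; rewrite !normrM mulrDl; apply: lerD.
  by rewrite -mulrA; apply: ler_pM.
by rewrite mulrAC; apply: ler_pM.
Qed.

Lemma tame_sum (I : finType) (F : I -> ('I_M -> R) -> 'rV[R]_k -> R) :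
  (forall i, tame (F i)) -> tame (fun w s => \sum_i F i w s).
Proof.
move=> tF; elim: (index_enum I) => [|i e IH].
  by apply: tame_eq (tame_cst 0) => w s; rewrite big_nil.
by apply: tame_eq (tameD (tF i) IH) => w s; rewrite big_cons.
Qed.

End Tame.

(** A point of the circuit: [k] parameters followed by [L] products. The entries are real numbers
    or, along a line, univariate polynomials. *)
Definition glue (k L : nat) (C : Type) (s : 'I_k -> C) (z : 'I_L -> C) (i : 'I_(k + L)) : C :=
  match split i with inl c => s c | inr l => z l end.

Lemma glue_lshift k L C (s : 'I_k -> C) (z : 'I_L -> C) i : glue s z (lshift L i) = s i.
Proof. by rewrite /glue (unsplitK (inl i : 'I_k + 'I_L)). Qed.

Lemma glue_rshift k L C (s : 'I_k -> C) (z : 'I_L -> C) j : glue s z (rshift k j) = z j.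
Proof. by rewrite /glue (unsplitK (inr j : 'I_k + 'I_L)). Qed.

Section AffineForms.
Variables (R C : comNzRingType) (phi : {rmorphism R -> C}) (n : nat).

(** [phi] is the identity for values at a point and [polyC] for restrictions to a line. *)
Definition affine (c0 : R) (c : 'I_n -> R) (x : 'I_n -> C) : C :=
  phi c0 + \sum_i phi (c i) * x i.

End AffineForms.

(** * Perturbed chains of products and their Lagrange equations *)

Section Chain.
Variables (R : realType) (k L : nat).
Variables (a0 b0 : 'I_L -> R) (a b : 'I_L -> 'I_(k + L) -> R).

(* The j-th product only involves the products of smaller index. *)
Definition triangular (c : 'I_L -> 'I_(k + L) -> R) : Prop :=
  forall j l : 'I_L, (j <= l)%N -> c j (rshift k l) = 0.

Hypotheses (a_tri : triangular a) (b_tri : triangular b).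

Lemma affine_tri (C : comNzRingType) (phi : {rmorphism R -> C}) c0 c
    (s : 'I_k -> C) (y z : 'I_L -> C) (j : 'I_L) : triangular c ->
  (forall l : 'I_L, (l < j)%N -> y l = z l) ->
  affine phi c0 (c j) (glue s y) = affine phi c0 (c j) (glue s z).
Proof.
move=> c_tri yz; congr (_ + _); apply: eq_bigr => i _.
rewrite -(splitK i) /unsplit; case: split => l.
  by rewrite !glue_lshift.
rewrite !glue_rshift; case: (ltnP l j) => [/yz -> //|jl].
by rewrite c_tri // raddf0 !mul0r.
Qed.

Definition products (C : comNzRingType) (phi : {rmorphism R -> C}) (w : 'I_L -> C)
    (s : 'I_k -> C) (z : 'I_L -> C) (j : 'I_L) : C :=
  affine phi (a0 j) (a j) (glue s z) * affine phi (b0 j) (b j) (glue s z) + w j.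

Lemma products_tri C phi w s y z (j : 'I_L) :
  (forall l : 'I_L, (l < j)%N -> y l = z l) ->
  @products C phi w s y j = @products C phi w s z j.
Proof.
move=> yz; rewrite /products (affine_tri phi _ s a_tri yz).
by rewrite (affine_tri phi _ s b_tri yz).
Qed.

Lemma products_solution C phi w s : exists z, forall j, z j = @products C phi w s z j.
Proof.
apply: (@triangular_solution _ _ (@nat_of_ord L)) => [y z j|]; first exact: products_tri.
exact: (fun=> 0).
Qed.

Lemma products_unique C phi w s y z : (forall j, y j = @products C phi w s y j) ->
  (forall j, z j = @products C phi w s z j) -> y =1 z.
Proof. by apply: (@triangular_unique _ _ (@nat_of_ord L)) => ? ? ?; exact: products_tri. Qed.

(** The partial derivative of the [j]-th product with respect to the [i]-th variable. *)
Definition slope (x : 'I_(k + L) -> R) (j : 'I_L) (i : 'I_(k + L)) : R :=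
  a j i * affine idfun (b0 j) (b j) x + b j i * affine idfun (a0 j) (a j) x.

Variable gam : 'I_(k + L) -> R.

(* The critical points of gam . x subject to the chain equations are the common
   zeros of these quadratic functions of x and of the Lagrange multipliers. *)
Definition lagrange (x : 'I_(k + L) -> R) (lam : 'I_L -> R) (l : 'I_(k + L + L)) : R :=
  match split l with
  | inl i => glue (fun=> 0) lam i - gam i - \sum_j lam j * slope x j i
  | inr j => x (rshift k j) -
      affine idfun (a0 j) (a j) x * affine idfun (b0 j) (b j) x
  end.

Definition lagrange_row (l : 'I_(k + L + L)) (u : 'rV[R]_(k + L + L)) : R :=
  lagrange (fun i => u 0 (lshift L i)) (fun j => u 0 (rshift (k + L) j)) l.

Lemma deg_le_affine c0 c :
  deg_le 1 (fun u : 'rV[R]_(k + L + L) => affine idfun c0 c (fun i => u 0 (lshift L i))).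
Proof.
apply: deg_leD; first exact: deg_le_cst.
by apply: deg_le_sum => i _; apply: deg_leZ; exact: deg_le_coord.
Qed.

Lemma lagrange_quadratic l : deg_le 2 (lagrange_row l).
Proof.
rewrite /lagrange_row /lagrange; case: split => [i|j].
  apply: deg_leD.
    apply: deg_leD; last exact: deg_le_cst.
    rewrite -(splitK i) /unsplit; case: split => j.
      apply: (@deg_le_eq _ _ _ (fun=> 0)) => [u|]; first by rewrite glue_lshift.
      exact: deg_le_cst.
    apply: (@deg_le_eq _ _ _ (fun u => u 0 (rshift (k + L) j))) => [u|].
      by rewrite glue_rshift.
    by apply: (@deg_le_leq _ _ 1) => //; exact: deg_le_coord.
  apply: (@deg_le_eq _ _ _ (fun u => -1 * _)) => [u|]; first by rewrite mulN1r.
  apply: deg_leZ; apply: deg_le_sum => j _.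
  apply: (@deg_leM _ _ 1 1); first exact: deg_le_coord.
  by apply: deg_leD; apply: deg_leZ; exact: deg_le_affine.
apply: deg_leD; first by apply: (@deg_le_leq _ _ 1) => //; exact: deg_le_coord.
apply: (@deg_le_eq _ _ _ (fun u => -1 * _)) => [u|]; first by rewrite mulN1r.
by apply: deg_leZ; apply: (@deg_leM _ _ 1 1); exact: deg_le_affine.
Qed.

(** Stationarity in the product variables determines the multipliers by back substitution: the slope
    of the product [j] in the product [l] is zero unless [l < j]. *)
Lemma multipliers x w : exists lam : 'I_L -> R,
  forall l, lam l = gam (rshift k l) + w (rshift k l) + \sum_j lam j * slope x j (rshift k l).
Proof.
apply: (@triangular_solution _ _ (fun l : 'I_L => L - l)%N) => [y z j yz|]; last exact: (fun=> 0).
congr (_ + _); apply: eq_bigr => i _; case: (ltnP j i) => [ji|ij].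
  by rewrite yz //; have := ltn_ord i; lia.
by rewrite /slope a_tri // b_tri // !mul0r addr0 !mulr0.
Qed.

End Chain.

(** * From local maxima to solutions of the Lagrange system *)

Section CriticalPoints.
Variables (R : realType) (k L : nat).
Variables (a0 b0 : 'I_L -> R) (a b : 'I_L -> 'I_(k + L) -> R).
Hypotheses (a_tri : triangular a) (b_tri : triangular b).
Variables (gam : 'I_(k + L) -> R) (w : 'I_(k + L + L) -> R).
Let wx i := w (lshift L i).
Let wz j := w (rshift (k + L) j).
Variable Z : 'rV[R]_k -> 'I_L -> R.
Hypothesis ZP : forall s j, Z s j = products a0 b0 a b idfun wz (s 0) (Z s) j.
Let X (s : 'rV[R]_k) := glue (s 0) (Z s).

Definition objective s : R := \sum_i (gam i + wx i) * X s i.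

(** On a line parallel to a coordinate axis the whole circuit consists of univariate polynomials, so
    maximality along such lines and the vanishing of one ordinary derivative suffice. *)
Lemma critical_point (p : 'rV[R]_k) (e : R) : 0 < e ->
  (forall c t, `|t| < e -> objective (p + t *: delta_mx 0 c) <= objective p) ->
  exists u : 'rV[R]_(k + L + L),
    (forall i, u 0 (lshift L (lshift L i)) = p 0 i) /\
    forall l, lagrange_row a0 b0 a b gam l u = w l.
Proof.
move=> e0 pmax; have [lam lamP] := multipliers a0 b0 a_tri b_tri gam (X p) wx.
exists (row_mx (\row_i X p i) (\row_j lam j)); split=> [i|l].
  by rewrite row_mxEl mxE /X glue_lshift.
have -> : lagrange_row a0 b0 a b gam l (row_mx (\row_i X p i) (\row_j lam j)) =
    lagrange a0 b0 a b gam (X p) lam l.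
  by congr lagrange; apply/funext => i; rewrite ?row_mxEl ?row_mxEr mxE.
rewrite /lagrange -(splitK l); case: (split l) => {l} [i|j]; rewrite unsplitK /=; last first.
  by rewrite /X glue_rshift {1}ZP /products addrAC subrr add0r.
(* The residual of the [i]-th stationarity equation. It vanishes at the product variables by the
   choice of [lam], so only the parameters [c] remain. *)
pose err i := glue (fun=> 0) lam i - gam i - wx i - \sum_j lam j * slope a0 b0 a b (X p) j i.
suff : err i = 0.
  by move=> /eqP; rewrite /err addrAC subr_eq0 => /eqP.
rewrite -(splitK i); case: (split i) => {i} [c|l] /=; last first.
  by rewrite /err glue_rshift [in X in X - _]lamP; ring.
(* The line through [p] in direction [c]; [zp] runs the perturbed circuit on it over the ring of
   polynomials. *)
pose sp (i : 'I_k) : {poly R} := (p 0 i)%:P + (i == c)%:R *: 'X.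
have [zp zpP] := products_solution a0 b0 a_tri b_tri polyC (fun j => (wz j)%:P) sp.
pose xp := glue sp zp.
have horner_affine c0 (d : 'I_(k + L) -> R) t :
    (affine polyC c0 d xp).[t] = affine idfun c0 d (fun i => (xp i).[t]).
  rewrite /affine hornerD hornerC horner_sum; congr (_ + _).
  by apply: eq_bigr => i _; rewrite hornerM hornerC.
have glue_horner t : (fun i => (xp i).[t]) = glue (fun i => (sp i).[t]) (fun j => (zp j).[t]).
  apply/funext => i; rewrite -(splitK i) /unsplit /xp; case: split => j.
    by rewrite !glue_lshift.
  by rewrite !glue_rshift.
have sp_line t : (fun i => (sp i).[t]) = (p + t *: delta_mx 0 c) 0.
  by apply/funext => i; rewrite !mxE /sp !hornerE /= mulrC.
have xp_X t i : (xp i).[t] = X (p + t *: delta_mx 0 c) i.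
  have zpZ : (fun j => (zp j).[t]) =1 Z (p + t *: delta_mx 0 c).
    apply: (products_unique (phi := idfun) a_tri b_tri) (ZP _) => j.
    rewrite {1}zpP /products hornerD hornerM hornerC !horner_affine.
    by rewrite glue_horner sp_line.
  rewrite /X -sp_line -(funext zpZ) -glue_horner //.
pose hp : {poly R} := \sum_i (gam i + wx i)%:P * xp i.
have hp_obj t : hp.[t] = objective (p + t *: delta_mx 0 c).
  rewrite horner_sum; apply: eq_bigr => i _.
  by rewrite hornerM hornerC xp_X.
have p0 : p + 0 *: delta_mx 0 c = p by rewrite scale0r addr0.
have hp_deriv : hp^`().[0] = 0.
  apply: (horner_local_max_deriv e0) => t te; rewrite !hp_obj p0; exact: pmax.
pose dx i := ((xp i)^`()).[0].
have xp0 : (fun i => (xp i).[0]) = X p by apply/funext => i; rewrite xp_X p0.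
have dxl i : dx (lshift L i) = (i == c)%:R.
  by rewrite /dx /xp glue_lshift /sp derivD derivC derivZ derivX add0r hornerZ hornerC mulr1.
have deriv_affine c0 (d : 'I_(k + L) -> R) :
    ((affine polyC c0 d xp)^`()).[0] = \sum_i d i * dx i.
  rewrite /affine derivD derivC add0r raddf_sum horner_sum; apply: eq_bigr => i _.
  by rewrite /= derivM derivC mul0r add0r hornerM hornerC.
have dxr j : dx (rshift k j) = \sum_i slope a0 b0 a b (X p) j i * dx i.
  rewrite {1}/dx {1}/xp glue_rshift zpP /products derivD derivC addr0 derivM hornerD.
  rewrite !hornerM !horner_affine !deriv_affine xp0 big_distrl big_distrr -big_split /=.
  by apply: eq_bigr => i _; rewrite /slope; ring.
have : \sum_i (gam i + wx i) * dx i = 0.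
  rewrite -[RHS]hp_deriv /hp raddf_sum horner_sum; apply: eq_bigr => i _ /=.
  by rewrite derivM derivC mul0r add0r hornerM hornerC.
(* The derivative of the objective is expanded by the stationarity equations. The two multiplier
   sums cancel, and since [dx] is 1 at [c] and 0 at the other parameters, only the residual at [c]
   survives. *)
have -> : \sum_i (gam i + wx i) * dx i = \sum_i glue (fun=> 0) lam i * dx i -
    \sum_j lam j * dx (rshift k j) - \sum_i err i * dx i.
  under [X in _ - X - _]eq_bigr => j _ do rewrite dxr big_distrr /=.
  rewrite [X in _ - X - _]exchange_big -!sumrB; apply: eq_bigr => i _ /=.
  under [X in _ - X - _]eq_bigr do rewrite mulrA.
  by rewrite -big_distrl /= /err; ring.
rewrite [X in X - _ - _]big_split_ord /= [X in (X + _) - _ - _]big1 => [|i _]; last first.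
  by rewrite glue_lshift mul0r.
under [X in (_ + X) - _ - _]eq_bigr do rewrite glue_rshift.
rewrite add0r subrr sub0r big_split_ord /= [X in _ + X]big1 => [|j _]; last first.
  have -> : err (rshift k j) = 0 by rewrite /err glue_rshift [in X in X - _]lamP; ring.
  by rewrite mul0r.
rewrite (bigD1 c) //= big1 => [|i /negPf ic]; last by rewrite dxl ic mulr0.
by rewrite dxl eqxx mulr1 !addr0 => /eqP; rewrite oppr_eq0 => /eqP.
Qed.

End CriticalPoints.

(** * Counting regions on which the output of a circuit is positive *)

Section ComponentCount.
Variables (R : realType) (k L N : nat) (r : R).
Variables (a0 b0 : 'I_L -> R) (a b : 'I_L -> 'I_(k + L) -> R).
Hypotheses (a_tri : triangular a) (b_tri : triangular b).
Variables (gam0 : R) (gam : 'I_(k + L) -> R) (Z : 'rV[R]_k -> 'I_L -> R).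
Hypothesis ZP : forall s j, Z s j = products a0 b0 a b idfun (fun=> 0) (s 0) (Z s) j.
Let g (s : 'rV[R]_k) := affine idfun gam0 gam (glue (s 0) (Z s)).
Variables (A : 'I_N -> set 'rV[R]_k) (s : 'I_N -> 'rV[R]_k).
Hypotheses (k_gt0 : (0 < k)%N) (r_ge0 : 0 <= r).
Hypothesis A_compact : forall i, compact (A i).
Hypothesis A_box : forall i y c, A i y -> `|y 0 c| <= r.
Hypotheses (As : forall i, A i (s i)) (gs : forall i, 0 < g (s i)).
Hypothesis A_open : forall i y, A i y -> 0 < g y -> nbhs y (A i).
Hypothesis A_disj : forall i j y, A i y -> A j y -> 0 < g y -> i = j.

(* On each A i, every small perturbation of g has an interior maximum, which is
   a solution of the correspondingly perturbed Lagrange system. *)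
Lemma component_count : (N <= 12 ^ (k + L + L))%N.
Proof.
case: (posnP N) => [->//|N_gt0].
pose wz (w : 'I_(k + L + L) -> R) j := w (rshift (k + L) j).
have /choice[Y YP] : forall w, exists Y : 'rV[R]_k -> 'I_L -> R,
    forall y j, Y y j = products a0 b0 a b idfun (wz w) (y 0) (Y y) j.
  move=> w.
  have [Y YP] := choice (fun y : 'rV[R]_k =>
    products_solution a0 b0 a_tri b_tri idfun (wz w) (y 0)).
  by exists Y.
pose obj w y := objective gam w (Y w) y.
have obj0 y : gam0 + obj (fun=> 0) y = g y.
  congr (_ + _); apply: eq_bigr => i _; rewrite addr0; congr (_ * glue _ _ _).
  by apply/funext; apply: (products_unique (phi := idfun) a_tri b_tri); [exact: YP|exact: ZP].
have tame_glue j : (forall l : 'I_L, (l < j)%N -> tame r (fun w y => Y w y l)) ->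
    forall c0 (c : 'I_L -> 'I_(k + L) -> R) (cj : 'I_L), (cj <= j)%N -> triangular c ->
    tame r (fun w y => affine idfun c0 (c cj) (glue (y 0) (Y w y))).
  move=> tY c0 c cj cjj c_tri; apply: tameD; first exact: tame_cst.
  apply: tame_sum => i; rewrite -(splitK i); case: (split i) => {i} l /=.
    apply: (@tame_eq _ _ _ _ (fun w y => c cj (lshift L l) * y 0 l)) => [w y|].
      by rewrite glue_lshift.
    by apply: tameM; [exact: tame_cst|exact: tame_coord].
  case: (ltnP l cj) => [lj|jl].
    apply: (@tame_eq _ _ _ _ (fun w y => c cj (rshift k l) * Y w y l)) => [w y|].
      by rewrite glue_rshift.
    by apply: tameM; [exact: tame_cst|apply: tY; apply: leq_trans lj cjj].
  apply: (@tame_eq _ _ _ _ (fun _ _ => 0)) => [w y|]; last exact: tame_cst.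
  by rewrite c_tri // mul0r.
have tameY j : tame r (fun w y => Y w y j).
  have [n] := ubnP j; elim: n j => // n IH j jn.
  apply: (@tame_eq _ _ _ _ (fun w y => affine idfun (a0 j) (a j) (glue (y 0) (Y w y)) *
    affine idfun (b0 j) (b j) (glue (y 0) (Y w y)) + w (rshift (k + L) j))) => [w y|].
    by rewrite [RHS]YP.
  have tl (l : 'I_L) : (l < j)%N -> tame r (fun w y => Y w y l) by move=> lj; apply: IH; lia.
  apply: tameD; last exact: tame_param.
  by apply: tameM; apply: (tame_glue j).
have tame_obj : tame r obj.
  apply: tame_sum => i; apply: tameM.
    by apply: tameD; [exact: tame_cst|exact: tame_param].
  rewrite -(splitK i); case: (split i) => {i} l /=.
    by apply: tame_eq (tame_coord _ l r_ge0) => w y; rewrite glue_lshift.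
  by apply: tame_eq (tameY l) => w y; rewrite glue_rshift.
have [cobj [C C0 CP]] := tame_obj.
have [eta eta0 etaP] : exists2 eta, 0 < eta & forall i, eta <= g (s i).
  exists (\big[Order.min/1]_i g (s i)); last by move=> i; exact: bigmin_le.
  by apply/lt_bigmin.
(* Perturbations up to [d] move the objective by at most [eta / 4]. At the maximum [p] of the
   perturbed objective, [g] is then at least [eta / 2], so [p] is interior to [A i]. *)
pose d := Num.min 1 (eta / (4 * (C + 1))).
have C1 : 0 < 4 * (C + 1) by lra.
have d0 : 0 < d by rewrite lt_min ltr01 divr_gt0.
have d1 : d <= 1 by rewrite ge_min lexx.
have Cd : 4 * (C * d) <= eta.
  have : d <= eta / (4 * (C + 1)) by rewrite ge_min lexx orbT.
  by rewrite ler_pdivlMr //; nra.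
apply: (@quadratic_preimages_bound R (k + L + L) N _ N_gt0
  (lagrange_row a0 b0 a b gam) _ d d0); first by rewrite -addnA ltn_addr.
  exact: lagrange_quadratic.
move=> w w01.
have Dobj y i : A i y -> `|obj w y - obj (fun=> 0) y| <= C * d.
  move=> Ay; apply: (CP d w y _ w01 _).2; first by rewrite ltW.
  by move=> c; exact: A_box Ay.
have /choice[p pP] : forall i, exists p,
    [/\ A i p, 0 < g p & forall y, A i y -> obj w y <= obj w p].
  move=> i; have [|||p pA pmax] := @EVT_max_rV R k (obj w) (A i).
  - by exists (s i).
  - exact: A_compact.
  - by apply: continuous_subspaceT; exact: cobj.
  move: pA; rewrite inE => pA; exists p; split=> //; last first.
    by move=> y Ay; apply: pmax; rewrite inE.
  have : obj w (s i) <= obj w p by apply: pmax; rewrite inE.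
  have := Dobj _ _ pA; have := Dobj _ _ (As i); have := etaP i; rewrite -!obj0.
  by rewrite !ler_norml => ? /andP[? ?] /andP[? ?] ?; lra.
have /choice[u uP] : forall i, exists u : 'rV[R]_(k + L + L),
    (forall c, u 0 (lshift L (lshift L c)) = p i 0 c) /\
    forall l, lagrange_row a0 b0 a b gam l u = w l.
  move=> i; have [pA gp pmax] := pP i.
  have /nbhs_ballP[e e0 eP] := A_open pA gp.
  apply: (critical_point a_tri b_tri (YP w) e0) => c t te; apply: pmax; apply: eP.
  split=> // i1 j1; rewrite !mxE /ball /= opprD addNKr normrN normrM.
  by apply: le_lt_trans te; rewrite ler_piMr //; case: (_ && _); rewrite ?normr1 ?normr0.
(* A solution contains the coordinates of its maximum, and the regions are disjoint where [g] is
   positive, so distinct regions give distinct solutions. *)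
exists u; split=> [i j uij|i l]; last by have [_ ->] := uP i.
have pij : p i = p j.
  by apply/rowP => c; rewrite -(uP i).1 -(uP j).1 uij.
by have [pA gp _] := pP i; have [pA' _ _] := pP j; apply: A_disj pA _ gp; rewrite pij.
Qed.

End ComponentCount.

(** * Polynomial functions and chains of products *)

Section PolynomialFunctions.
Variables (R : realType) (k : nat).
Implicit Types f g : 'rV[R]_k -> R.

(** Continuity and polynomial restrictions to lines replace multivariate polynomials; they suffice
    for the identity principle. *)
Definition polyfun f : Prop :=
  continuous f /\
  forall s v : 'rV[R]_k, exists p : {poly R}, forall t, f (s + t *: v) = p.[t].

Lemma polyfun_cst c : polyfun (fun=> c).
Proof.
by split=> [s|s v]; [exact: cst_continuous|exists c%:P => t; rewrite hornerC].
Qed.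

Lemma polyfun_coord i : polyfun (fun s => s 0 i).
Proof.
split=> [|s v]; first exact: (@coord_continuous R 1 k 0 i).
exists ((s 0 i)%:P + (v 0 i) *: 'X) => t.
by rewrite !mxE !hornerE mulrC.
Qed.

Lemma polyfunD f g : polyfun f -> polyfun g -> polyfun (fun s => f s + g s).
Proof.
move=> [cf pf] [cg pg]; split=> [s|s v].
  exact: (continuousD (cf s) (cg s)).
have [p pP] := pf s v; have [q qP] := pg s v.
by exists (p + q) => t; rewrite hornerD pP qP.
Qed.

Lemma polyfunM f g : polyfun f -> polyfun g -> polyfun (fun s => f s * g s).
Proof.
move=> [cf pf] [cg pg]; split=> [s|s v].
  exact: (continuousM (cf s) (cg s)).
have [p pP] := pf s v; have [q qP] := pg s v.
by exists (p * q) => t; rewrite hornerM pP qP.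
Qed.

Lemma polyfun_sum (I : Type) (r : seq I) (F : I -> 'rV[R]_k -> R) :
  (forall i, polyfun (F i)) -> polyfun (fun s => \sum_(i <- r) F i s).
Proof.
move=> pF; elim: r => [|i r IH].
  by under eq_fun do rewrite big_nil; exact: polyfun_cst.
by under eq_fun do rewrite big_cons; exact: polyfunD.
Qed.

Lemma poly_eq0_near0 (p : {poly R}) (e : R) :
  0 < e -> (forall t, `|t| < e -> p.[t] = 0) -> p = 0.
Proof.
move=> e0 p0; apply: (@roots_geq_poly_eq0 _ p [seq e / i.+2%:R | i <- iota 0 (size p)]).
- apply/allP => t /mapP[i _ ->]; apply/rootP; apply: p0.
  rewrite ger0_norm ?divr_ge0 ?ltW //= ltr_pdivrMr ?ltr0n //.
  by rewrite ltr_pMr // ltr1n.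
- rewrite map_inj_uniq ?iota_uniq // => i j /(mulfI (lt0r_neq0 e0)) /invr_inj /eqP.
  by rewrite eqr_nat => /eqP[].
by rewrite size_map size_iota.
Qed.

(** On the line from [s0] to [s] the function is a univariate polynomial that vanishes near 0, hence
    also at 1. *)
Lemma polyfun_eq0_nbhs f (s0 : 'rV[R]_k) : polyfun f ->
  (\forall s \near s0, f s = 0) -> forall s, f s = 0.
Proof.
move=> [_ pf] f0 s; have [p pP] := pf s0 (s - s0).
have /nbhs_ballP[e e0 eP] := f0.
suff p0 : p = 0.
  by have := pP 1; rewrite scale1r addrC subrK p0 horner0.
have C0 : 0 < 1 + `|s - s0| by rewrite ltr_wpDr.
apply: (@poly_eq0_near0 _ (e / (1 + `|s - s0|))) => [|t te]; first exact: divr_gt0.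
rewrite -pP; apply: eP; rewrite -ball_normE /= opprD addNKr normrN normrZ.
move: te; rewrite ltr_pdivlMr // => te; apply: le_lt_trans te.
by rewrite ler_wpM2l // lerDr.
Qed.

Lemma polyfun_eq0_open f O : polyfun f -> open O -> O !=set0 ->
  (forall s, O s -> f s = 0) -> forall s, f s = 0.
Proof.
move=> pf oO [s0 Os0] f0; apply: (@polyfun_eq0_nbhs _ s0 pf).
by apply: filterS f0 _; exact: open_nbhs_nbhs.
Qed.

(* A continuous function with values in the naturals is locally constant. *)
Lemma polyfun_nat_quotient f g O : polyfun f -> polyfun g -> open O -> O !=set0 ->
  (forall s, O s -> g s != 0 /\ f s / g s \is a Num.nat) ->
  exists a : nat, forall s, f s = a%:R * g s.
Proof.
move=> pf pg oO [s0 Os0] fgO; have [g0 /natrP[a aP]] := fgO _ Os0.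
exists a => s; apply/eqP; rewrite -subr_eq0; apply/eqP.
suff : \forall s \near s0, f s + -1 * (a%:R * g s) = 0.
  move=> /polyfun_eq0_nbhs/(_ s); rewrite mulN1r; apply.
  apply: polyfunD => //; apply: polyfunM; first exact: polyfun_cst.
  by apply: polyfunM => //; exact: polyfun_cst.
have cq : {for s0, continuous (fun s => f s / g s)}.
  by apply: continuousM; [exact: pf.1|apply: continuousV => //; exact: pg.1].
have : \forall s \near s0, `|f s0 / g s0 - f s / g s| < 1.
  by move: cq => /cvgrPdist_lt/(_ 1 ltr01).
have : \forall s \near s0, O s by exact: open_nbhs_nbhs.
apply: filterS2 => s' Os'; rewrite aP; have [g' /natrP[b bP]] := fgO _ Os'.
rewrite bP => ab; have {}ab : a = b.
  apply/eqP; rewrite -(eqr_nat R); move: ab.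
  case: (ltngtP a b) => [lt|lt|->]; rewrite ?eqxx // ltr_norml;
    move: lt; rewrite -(ler_nat R) -natr1; lra.
by rewrite ab -bP divfK // mulN1r subrr.
Qed.

End PolynomialFunctions.

(** * Functions computed with a bounded number of multiplications *)

Section Chains.
Variables (R : realType) (k : nat).
Notation V := 'rV[R]_k.
Implicit Types (Z : seq (V -> R)) (f g : V -> R).

Definition lin Z f : Prop := exists c (a : 'I_k -> R) (b : nat -> R), forall s,
  f s = c + \sum_i a i * s 0 i + \sum_(j < size Z) b j * nth (fun=> 0) Z j s.

(** A straight-line program in which affine combinations are free, so that the length of [Z] counts
    the multiplications. *)
Definition chain Z : Prop := forall j, (j < size Z)%N -> exists A B,
  [/\ lin (take j Z) A, lin (take j Z) B & forall s, nth (fun=> 0) Z j s = A s * B s].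

Lemma lin_cst Z c : lin Z (fun=> c).
Proof.
exists c, (fun=> 0), (fun=> 0) => s.
by rewrite !big1 ?addr0 // => i _; rewrite mul0r.
Qed.

Lemma lin_coord Z i : lin Z (fun s => s 0 i).
Proof.
exists 0, (fun j => (j == i)%:R), (fun=> 0) => s.
rewrite [X in _ + X]big1 ?addr0 ?add0r => [|j _]; last by rewrite mul0r.
rewrite (bigD1 i) //= eqxx mul1r big1 ?addr0 // => j /negPf ->.
by rewrite mul0r.
Qed.

Lemma linD Z f g : lin Z f -> lin Z g -> lin Z (fun s => f s + g s).
Proof.
move=> [c [a [b fP]]] [c' [a' [b' gP]]].
exists (c + c'), (fun i => a i + a' i), (fun j => b j + b' j) => s.
rewrite fP gP; under [in RHS]eq_bigr do rewrite mulrDl.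
under [X in _ = _ + X]eq_bigr do rewrite mulrDl.
by rewrite !big_split /=; ring.
Qed.

Lemma linZ Z x f : lin Z f -> lin Z (fun s => x * f s).
Proof.
move=> [c [a [b fP]]].
exists (x * c), (fun i => x * a i), (fun j => x * b j) => s.
rewrite fP !mulrDr !big_distrr /=.
by congr (_ + _ + _); apply: eq_bigr => i _; rewrite mulrA.
Qed.

Lemma linB Z f g : lin Z f -> lin Z g -> lin Z (fun s => f s - g s).
Proof.
move=> lf lg; have := linD lf (linZ (-1) lg).
by under eq_fun do rewrite mulN1r.
Qed.

Lemma lin_weaken Z Z' f : lin Z f -> lin (Z ++ Z') f.
Proof.
move=> [c [a [b fP]]]; exists c, a, (fun j => if (j < size Z)%N then b j else 0) => s.
rewrite fP size_cat big_split_ord /= [X in _ = _ + (_ + X)]big1 ?addr0 => [|j _].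
  by congr (_ + _); apply: eq_bigr => j _; rewrite ltn_ord nth_cat ltn_ord.
by rewrite ltnNge leq_addr mul0r.
Qed.

Lemma lin_last Z f : lin (rcons Z f) f.
Proof.
exists 0, (fun=> 0), (fun j => (j == size Z)%:R) => s.
rewrite size_rcons big_ord_recr /= eqxx mul1r nth_rcons ltnn eqxx.
rewrite !big1 ?add0r // => j _; last by rewrite mul0r.
by rewrite ltn_eqF ?mul0r.
Qed.

Lemma chain_rcons Z f g : chain Z -> lin Z f -> lin Z g ->
  chain (rcons Z (fun s => f s * g s)).
Proof.
move=> cZ lf lg j; rewrite size_rcons ltnS leq_eqVlt => /orP[/eqP ->|jZ].
  by exists f, g; rewrite -cats1 take_size_cat //; split=> // s; rewrite cats1 nth_rcons ltnn eqxx.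
have [A [B [lA lB AB]]] := cZ j jZ; exists A, B.
rewrite -cats1 takel_cat ?(ltnW jZ) //; split=> // s.
by rewrite nth_cat jZ.
Qed.

Lemma chain_polyfun Z : chain Z -> forall j, polyfun (nth (fun=> 0) Z j).
Proof.
move=> cZ j; have [n] := ubnP j; elim: n j => // n IH j jn.
case: (ltnP j (size Z)) => [jZ|Zj]; last by rewrite nth_default //; exact: polyfun_cst.
have [A [B [lA lB /funext ->]]] := cZ j jZ.
suff H f : lin (take j Z) f -> polyfun f by apply: polyfunM; exact: H.
move=> [c [a [b /funext ->]]].
apply: polyfunD; first apply: polyfunD; first exact: polyfun_cst.
  by apply: polyfun_sum => i; apply: polyfunM; [exact: polyfun_cst|exact: polyfun_coord].
apply: polyfun_sum => i; apply: polyfunM; first exact: polyfun_cst.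
have ij : (i < j)%N by rewrite (leq_trans (ltn_ord i)) // size_take_min geq_minl.
by rewrite nth_take //; apply: IH; lia.
Qed.

Lemma lin_polyfun Z f : chain Z -> lin Z f -> polyfun f.
Proof.
move=> cZ [c [a [b /funext ->]]].
apply: polyfunD; first apply: polyfunD; first exact: polyfun_cst.
  by apply: polyfun_sum => i; apply: polyfunM; [exact: polyfun_cst|exact: polyfun_coord].
apply: polyfun_sum => i; apply: polyfunM; first exact: polyfun_cst.
exact: chain_polyfun.
Qed.

Lemma chain_component_count Z g (N : nat) (r : R) (A : 'I_N -> set V) (s : 'I_N -> V) :
  chain Z -> lin Z g -> (0 < k)%N -> 0 <= r ->
  (forall i, compact (A i)) ->
  (forall i y c, A i y -> `|y 0 c| <= r) ->
  (forall i, A i (s i)) -> (forall i, 0 < g (s i)) ->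
  (forall i y, A i y -> 0 < g y -> nbhs y (A i)) ->
  (forall i j y, A i y -> A j y -> 0 < g y -> i = j) ->
  (N <= 12 ^ (k + size Z + size Z))%N.
Proof.
move=> cZ [c [al [be gP]]] k0 r0 Ac Abox As gs Aopen Adisj.
have H (j : 'I_(size Z)) : exists q : R * ('I_(k + size Z) -> R) * (R * ('I_(k + size Z) -> R)),
    [/\ forall l : 'I_(size Z), (j <= l)%N -> q.1.2 (rshift k l) = 0 /\ q.2.2 (rshift k l) = 0 &
     forall s, nth (fun=> 0) Z j s =
      affine idfun q.1.1 q.1.2 (glue (s 0) (fun l => nth (fun=> 0) Z l s)) *
      affine idfun q.2.1 q.2.2 (glue (s 0) (fun l => nth (fun=> 0) Z l s))].
  have [f [h [lf lh fh]]] := cZ j (ltn_ord j).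
  suff K f' : lin (take j Z) f' -> exists q : R * ('I_(k + size Z) -> R),
      (forall l : 'I_(size Z), (j <= l)%N -> q.2 (rshift k l) = 0) /\
      forall s, f' s = affine idfun q.1 q.2 (glue (s 0) (fun l => nth (fun=> 0) Z l s)).
    have [q [q1 q2]] := K _ lf; have [q' [q1' q2']] := K _ lh.
    by exists (q, q'); split=> [l jl|y]; [split; [exact: q1|exact: q1']|rewrite fh q2 q2'].
  move=> [c' [a [b fP]]].
  (* Coefficients at the products from [j] on are set to 0, which makes the arrays triangular. *)
  exists (c', glue a (fun l : 'I_(size Z) => if (l < j)%N then b l else 0)); split=> [l jl|y] /=.
    by rewrite glue_rshift ltnNge jl.
  rewrite fP /affine big_split_ord /= -addrA; congr (_ + (_ + _)).
    by apply: eq_bigr => i _; rewrite !glue_lshift.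
  rewrite size_take ltn_ord -(big_mkord xpredT (fun i => b i * nth (fun=> 0) (take j Z) i y)).
  rewrite (big_nat_widen _ _ (size Z)) ?(ltnW (ltn_ord j)) // big_mkord big_mkcond /=.
  apply: eq_bigr => i _; rewrite !glue_rshift; case: ifP => ij; last by rewrite mul0r.
  by rewrite nth_take.
have [q qP] := choice H.
have gE y : g y = affine idfun c (glue al (fun l : 'I_(size Z) => be l))
    (glue (y 0) (fun l => nth (fun=> 0) Z l y)).
  rewrite gP /affine big_split_ord /= -addrA; congr (_ + (_ + _)); apply: eq_bigr => i _.
    by rewrite !glue_lshift.
  by rewrite !glue_rshift.
apply: (@component_count R k (size Z) N r (fun j => (q j).1.1) (fun j => (q j).2.1)
  (fun j => (q j).1.2) (fun j => (q j).2.2) _ _ c (glue al (fun l : 'I_(size Z) => be l))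
  (fun y l => nth (fun=> 0) Z l y) _ A s) => //.
- by move=> j l jl; have [/(_ l jl)[]] := qP j.
- by move=> j l jl; have [/(_ l jl)[]] := qP j.
- by move=> y j; rewrite /products addr0; have [_ ->] := qP j.
- by move=> i; rewrite -gE.
- by move=> i y Ay; rewrite -gE => gy; exact: Aopen.
- by move=> i j y Ay Ay'; rewrite -gE; exact: Adisj.
Qed.

End Chains.

(** * Symbolic execution *)

Section Execution.
Variables (R : realType) (P : program R).
Implicit Types c : config R.

(** Staying put after halting allows all inputs to be compared at one common time. *)
Definition step_or_stay c := odflt c (step P c).

Definition at_time t c := iter t step_or_stay c.

Lemma halted_step c : halted P c -> step P c = None.
Proof. by rewrite /halted /step; case: c => l r m; case: current. Qed.

Lemma runS t c : run P t.+1 c = obind (step P) (run P t c).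
Proof. by []. Qed.

Lemma run_at_time t c c' : run P t c = Some c' -> at_time t c = c'.
Proof.
elim: t c' => [|t IH] c' /=; first by case.
rewrite -/(run P t c); case E: (run P t c) => [c1|] //= E1.
by rewrite /at_time /= -/(at_time t c) (IH _ E) /step_or_stay E1.
Qed.

Lemma run_prefix t t' c c' : (t <= t')%N -> run P t' c = Some c' ->
  exists c1, run P t c = Some c1.
Proof.
elim: t' c' => [|t' IH] c'; first by rewrite leqn0 => /eqP ->; exists c.
rewrite leq_eqVlt => /orP[/eqP ->|]; first by exists c'.
rewrite ltnS runS => tt'; case E: (run P t' c) => [c1|] //= _; exact: IH E.
Qed.

Lemma halts_in_at_time t t' c c' : halts_in P c t c' -> (t <= t')%N -> at_time t' c = c'.
Proof.
move=> [rc hc] /subnKC <-; elim: (t' - t)%N => [|d IH]; first by rewrite addn0; exact: run_at_time.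
by rewrite addnS /at_time /= -/(at_time (t + d) c) IH /step_or_stay halted_step.
Qed.

Lemma halts_in_no_error t c c' t' : halts_in P c t c' ->
  halted P (at_time t' c) \/ step P (at_time t' c) = Some (at_time t'.+1 c).
Proof.
move=> H; case: (leqP t t') => tt'.
  by left; rewrite (halts_in_at_time H tt'); exact: H.2.
right; have [c1] := run_prefix tt' H.1.
rewrite runS; case E: (run P t' c) => [c2|] //= E1.
by rewrite /at_time /= -/(at_time t' c) (run_at_time E) /step_or_stay E1.
Qed.

End Execution.

(** * Symbolic states along a sequence of branch outcomes *)

Section Symbolic.
Variables (R : realType) (k : nat) (P : program R).
Notation V := 'rV[R]_k.

(* Each register or memory cell holds num / den, two polynomial functions of the
   parameters; the tests are those, not identically zero, made so far, signed
   so as to be positive on the inputs that follow the current path. *)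
Record sstate := SState {
  spc : nat;
  snum : nat -> V -> R;
  sden : nat -> V -> R;
  mnum : nat -> V -> R;
  mden : nat -> V -> R;
  tests : seq (V -> R)
}.

Definition fupdate (f : nat -> V -> R) (a : nat) (g : V -> R) : nat -> V -> R :=
  fun b => if b == a then g else f b.

Definition constant_address (n d : V -> R) (a : nat) : Prop := forall s, n s = a%:R * d s.

(** The default 0 is harmless: correctness of a symbolic step assumes [good_address]. *)
Definition saddress (n d : V -> R) : nat := xget 0%N (constant_address n d).

Definition scurrent st : instr R := nth Halt P (spc st).

(** The difference of the two registers times the square of the product of their denominators: it
    has the sign of the difference and needs no division. *)
Definition diff_test st i j : V -> R := fun s =>
  (snum st i s * sden st j s - snum st j s * sden st i s) * (sden st i s * sden st j s).

(** Equality of the registers counts as an outcome only when it holds identically; any other test is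
    taken to be strict. *)
Definition branch_outcome (o : cmp_op) (trivial smaller : bool) : bool :=
  match o with
  | CmpLt => ~~ trivial && smaller
  | CmpLe => trivial || smaller
  | CmpEq => trivial
  end.

Definition sstep (smaller : bool) st : sstate :=
  let: SState l n d mn md ts := st in
  match scurrent st with
  | Const i x => SState l.+1 (fupdate n i (fun=> x)) (fupdate d i (fun=> 1)) mn md ts
  | Move i j => SState l.+1 (fupdate n i (n j)) (fupdate d i (d j)) mn md ts
  | Read i j => let a := saddress (n j) (d j) in
      SState l.+1 (fupdate n i (mn a)) (fupdate d i (md a)) mn md ts
  | Write i j => let a := saddress (n i) (d i) in
      SState l.+1 n d (fupdate mn a (n j)) (fupdate md a (d j)) ts
  | Arith Add i j h => SState l.+1
      (fupdate n i (fun s => n j s * d h s + n h s * d j s))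
      (fupdate d i (fun s => d j s * d h s)) mn md ts
  | Arith Defs.Sub i j h => SState l.+1
      (fupdate n i (fun s => n j s * d h s - n h s * d j s))
      (fupdate d i (fun s => d j s * d h s)) mn md ts
  | Arith Mul i j h => SState l.+1
      (fupdate n i (fun s => n j s * n h s))
      (fupdate d i (fun s => d j s * d h s)) mn md ts
  | Arith Div i j h => SState l.+1
      (fupdate n i (fun s => n j s * d h s))
      (fupdate d i (fun s => d j s * n h s)) mn md ts
  | Jump l' => SState l' n d mn md ts
  | Branch o i j l' =>
      let F := diff_test st i j in
      let trivial := `[< forall s, F s = 0 >] in
      SState (if branch_outcome o trivial smaller then l' else l.+1) n d mn md
        (if trivial then ts else (fun s => (if smaller then -1 else 1) * F s) :: ts)
  | Halt => st
  end.

Definition followed st (s : V) : Prop := forall f, List.In f (tests st) -> 0 < f s.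

Definition agree st (s : V) (c : config R) : Prop :=
  [/\ pc c = spc st,
      forall i, sden st i s != 0 /\ reg c i = snum st i s / sden st i s
    & forall a, mden st a s != 0 /\ memory c a = mnum st a s / mden st a s].

Definition good_address st : Prop :=
  match scurrent st with
  | Read _ j => exists a, constant_address (snum st j) (sden st j) a
  | Write i _ => exists a, constant_address (snum st i) (sden st i) a
  | _ => True
  end.

Lemma saddressP n d : (exists a, constant_address n d a) -> constant_address n d (saddress n d).
Proof. by move=> [a aP]; rewrite /saddress; case: xgetP => [x -> //|/(_ a)]. Qed.

Lemma agree_fupdate (n d : nat -> V -> R) (f g : V -> R) (r : nat -> R) i x s :
  (forall j, d j s != 0 /\ r j = n j s / d j s) -> g s != 0 -> x = f s / g s ->
  forall j, fupdate d i g j s != 0 /\ update r i x j = fupdate n i f j s / fupdate d i g j s.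
Proof. move=> H g0 fg j; rewrite /fupdate /update.
by case: (j =P i) => _; [split|exact: H].
Qed.

Lemma address_quotient (n d : V -> R) s x : d s != 0 -> (exists a, constant_address n d a) ->
  address (n s / d s) = Some x -> saddress n d = x.
Proof.
move=> d0 /saddressP ad; rewrite /address ad mulfK // natr_nat natrK.
by case.
Qed.

Lemma sstep_agree b st s c c' : agree st s c -> step P c = Some c' ->
  good_address st -> followed (sstep b st) s -> agree (sstep b st) s c'.
Proof.
case: st => l n d mn md ts; case: c => l' r m [/= -> rP mP].
rewrite /step /good_address /sstep /current /scurrent /=.
case: (nth Halt P l) => [i x|i j|i j|i j|o i j h|l1|o i j l1|] //=.
- move=> [<-] _ _; split=> //=.
  by apply: agree_fupdate; rewrite /= ?oner_eq0 ?divr1.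
- move=> [<-] _ _; split=> //=.
  by have [d0 ->] := rP j; exact: agree_fupdate.
- have [d0 ->] := rP j; case E: address => [x|] //= [<-] /address_quotient-/(_ s x d0 E) -> _.
  by split=> //=; have [m0 ->] := mP x; exact: agree_fupdate.
- have [d0 ->] := rP i; case E: address => [x|] //= [<-] /address_quotient-/(_ s x d0 E) -> _.
  by split=> //=; have [m0 ->] := rP j; exact: agree_fupdate.
- have [d0 ->] := rP j; have [d1 ->] := rP h; case: o => /=.
  + move=> [<-] _ _; split=> //=; apply: agree_fupdate; rewrite ?mulf_neq0 //.
    by rewrite addf_div.
  + move=> [<-] _ _; split=> //=; apply: agree_fupdate; rewrite ?mulf_neq0 //.
    by rewrite -mulNr addf_div // mulNr.
  + move=> [<-] _ _; split=> //=; apply: agree_fupdate; rewrite ?mulf_neq0 //.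
    by rewrite mulf_div.
  + case: eqP => // /eqP nd [<-] _ _.
    have n0 : n h s != 0 by apply: contraNneq nd => ->; rewrite mul0r.
    split=> //=; apply: agree_fupdate; rewrite ?mulf_neq0 //.
    by rewrite invf_div mulf_div.
- by move=> [<-].
move=> [<-] _ fol; split=> //=; congr (if _ then _ else _).
have [d0 ->] := rP i; have [d1 ->] := rP j.
move: fol; rewrite /diff_test /=.
have dd : 0 < (d i s * d j s) ^+ 2 by rewrite exprn_even_gt0 //= mulf_neq0.
have E : (n i s * d j s - n j s * d i s) * (d i s * d j s) =
    (n i s / d i s - n j s / d j s) * (d i s * d j s) ^+ 2 by field; rewrite d0 d1.
case: asboolP => [triv _|ntriv /(_ _ (or_introl erefl))].
  have /eqP := triv s; rewrite E mulf_eq0 (gt_eqF dd) orbF subr_eq0 => /eqP ->.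
  by case: (o) => /=; rewrite ?ltxx ?lexx ?eqxx.
rewrite E mulrA pmulr_lgt0 //; case: b => [|] pos.
  have lt : n i s / d i s < n j s / d j s by rewrite -subr_lt0; move: pos; lra.
  by case: (o) => /=; rewrite ?lt ?(ltW lt) ?(lt_eqF lt).
have lt : n j s / d j s < n i s / d i s by rewrite -subr_gt0; move: pos; lra.
by case: (o) => /=; rewrite ?(lt_gtF lt) ?(leNgt, lt) ?(gt_eqF lt).
Qed.

Lemma sstep_followed b st s : followed (sstep b st) s -> followed st s.
Proof.
case: st => l n d mn md ts; rewrite /sstep.
case: scurrent => [i x|i j|i j|i j|o i j h|l'|o i j l'|] //=; first by case: o.
by case: asboolP => // _ H f fts; apply: H; right.
Qed.

Definition test_product st : V -> R := fun s => foldr (fun f x => x * f s) 1 (tests st).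

(** The product of the tests is kept on the chain during execution, at the price of one
    multiplication per test. *)
Definition on_chain Z st : Prop :=
  [/\ chain Z, forall i, lin Z (snum st i) /\ lin Z (sden st i),
      forall a, lin Z (mnum st a) /\ lin Z (mden st a),
      forall f, List.In f (tests st) -> lin Z f & lin Z (test_product st)].

Lemma lin_fupdate Z (n : nat -> V -> R) i f : (forall j, lin Z (n j)) -> lin Z f ->
  forall j, lin Z (fupdate n i f j).
Proof. by move=> H lf j; rewrite /fupdate; case: eqP. Qed.

Lemma on_chain_product Z st f g : on_chain Z st -> lin Z f -> lin Z g ->
  on_chain (rcons Z (fun s => f s * g s)) st /\
  lin (rcons Z (fun s => f s * g s)) (fun s => f s * g s) /\
  forall h, lin Z h -> lin (rcons Z (fun s => f s * g s)) h.
Proof.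
move=> [cZ lr lm lt lp] lf lg.
have W h : lin Z h -> lin (rcons Z (fun s => f s * g s)) h.
  by rewrite -cats1; exact: lin_weaken.
split; last by split; [exact: lin_last|].
split=> [|i|a|h ht|]; last exact: W.
- exact: chain_rcons.
- by split; apply: W; [exact: (lr i).1|exact: (lr i).2].
- by split; apply: W; [exact: (lm a).1|exact: (lm a).2].
by apply: W; exact: lt.
Qed.

Lemma on_chain_update l Z st i f g : on_chain Z st -> lin Z f -> lin Z g ->
  on_chain Z (SState l (fupdate (snum st) i f) (fupdate (sden st) i g)
    (mnum st) (mden st) (tests st)).
Proof.
move=> [cZ lr lm lt lp] lf lg; split=> //= j.
by split; apply: lin_fupdate => // h; [exact: (lr h).1|exact: (lr h).2].
Qed.

(** The costliest instruction is a nontrivial branch: four multiplications form the test and a fifth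
    adds it to the product of tests. A sum takes three. *)
Lemma sstep_chain b Z st : on_chain Z st ->
  exists2 Z', on_chain Z' (sstep b st) & (size Z' <= size Z + 5)%N.
Proof.
move=> ocZ; have [cZ lr lm lt lp] := ocZ.
case: st ocZ lr lm lt lp => l n d mn md ts ocZ lr lm lt lp.
rewrite /sstep; case: scurrent => [i x|i j|i j|i j|o i j h|l1|o i j l1|].
- exists Z; last exact: leq_addr.
  by apply: (on_chain_update _ _ ocZ); exact: lin_cst.
- exists Z; last exact: leq_addr.
  by apply: (on_chain_update _ _ ocZ); [exact: (lr j).1|exact: (lr j).2].
- exists Z; last exact: leq_addr.
  by apply: (on_chain_update _ _ ocZ); [exact: (lm _).1|exact: (lm _).2].
- exists Z; last exact: leq_addr; split=> //= a.
  split; apply: lin_fupdate => [h|].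
  - exact: (lm h).1.
  - exact: (lr j).1.
  - exact: (lm h).2.
  - exact: (lr j).2.
- have [nj dj] := lr j; have [nh dh] := lr h; move: nj dj nh dh => /= nj dj nh dh.
  case: o.
  + have [oc1 [l1 W1]] := on_chain_product ocZ nj dh.
    have [oc2 [l2 W2]] := on_chain_product oc1 (W1 _ nh) (W1 _ dj).
    have [oc3 [l3 W3]] := on_chain_product oc2 (W2 _ (W1 _ dj)) (W2 _ (W1 _ dh)).
    eexists; last first; [|apply: (on_chain_update _ _ oc3 _ l3)].
      by rewrite !size_rcons; lia.
    by apply: linD; [exact: W3 _ (W2 _ l1)|exact: W3 _ l2].
  + have [oc1 [l1 W1]] := on_chain_product ocZ nj dh.
    have [oc2 [l2 W2]] := on_chain_product oc1 (W1 _ nh) (W1 _ dj).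
    have [oc3 [l3 W3]] := on_chain_product oc2 (W2 _ (W1 _ dj)) (W2 _ (W1 _ dh)).
    eexists; last first; [|apply: (on_chain_update _ _ oc3 _ l3)].
      by rewrite !size_rcons; lia.
    by apply: linB; [exact: W3 _ (W2 _ l1)|exact: W3 _ l2].
  + have [oc1 [l1 W1]] := on_chain_product ocZ nj nh.
    have [oc2 [l2 W2]] := on_chain_product oc1 (W1 _ dj) (W1 _ dh).
    eexists; last first; [|apply: (on_chain_update _ _ oc2 (W2 _ l1) l2)].
      by rewrite !size_rcons; lia.
  + have [oc1 [l1 W1]] := on_chain_product ocZ nj dh.
    have [oc2 [l2 W2]] := on_chain_product oc1 (W1 _ dj) (W1 _ nh).
    eexists; last first; [|apply: (on_chain_update _ _ oc2 (W2 _ l1) l2)].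
      by rewrite !size_rcons; lia.
- by exists Z; [|exact: leq_addr].
- have [ni di] := lr i; have [nj dj] := lr j; move: ni di nj dj => /= ni di nj dj.
  case: asboolP => _; first by exists Z; [|exact: leq_addr].
  have [oc1 [l1' W1]] := on_chain_product ocZ ni dj.
  have [oc2 [l2 W2]] := on_chain_product oc1 (W1 _ nj) (W1 _ di).
  have [oc3 [l3 W3]] := on_chain_product oc2 (W2 _ (W1 _ di)) (W2 _ (W1 _ dj)).
  have [oc4 [l4 W4]] := on_chain_product oc3 (linB (W3 _ (W2 _ l1')) (W3 _ l2)) l3.
  have l5 := linZ (if b then -1 else 1) l4.
  have lp4 := W4 _ (W3 _ (W2 _ (W1 _ lp))).
  have [[cZ5 lr5 lm5 lt5 lp5] [l6 W5]] := on_chain_product oc4 lp4 l5.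
  eexists; last first; [|split; [exact: cZ5|exact: lr5|exact: lm5| |exact: l6]].
    by rewrite !size_rcons; lia.
  by move=> f /= [<-|]; [exact: W5|exact: lt5].
- by exists Z; [|exact: leq_addr].
Qed.

Definition srun (bits : seq bool) st := foldl (fun st b => sstep b st) st bits.

Lemma srun_rcons bits b st : srun (rcons bits b) st = sstep b (srun bits st).
Proof. by rewrite /srun foldl_rcons. Qed.

Lemma srun_chain bits Z st : on_chain Z st ->
  exists2 Z', on_chain Z' (srun bits st) & (size Z' <= size Z + 5 * size bits)%N.
Proof.
elim/last_ind: bits => [|bits b IH] oc; first by exists Z => //=; lia.
have [Z1 oc1 s1] := IH oc; have [Z2 oc2 s2] := sstep_chain b oc1.
by exists Z2; rewrite ?srun_rcons // size_rcons; lia.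
Qed.

Lemma followed_open Z st : on_chain Z st -> open [set s | followed st s].
Proof.
move=> [cZ _ _ lt _]; rewrite /followed; move: (tests st) lt => ts.
elim: ts => [|f ts IH] lt.
  have -> : [set s | forall f : V -> R, List.In f [::] -> 0 < f s] = setT.
    by apply/seteqP; split=> // s _ f [].
  exact: openT.
have -> : [set s | forall f0 : V -> R, List.In f0 (f :: ts) -> 0 < f0 s] =
    (f @^-1` [set x | 0 < x]) `&` [set s | forall f : V -> R, List.In f ts -> 0 < f s].
  apply/seteqP; split=> s /=.
    by move=> H; split=> [|h hts]; apply: H; [left|right].
  by move=> [fs H] h [<-//|]; exact: H.
apply: openI; last by apply: IH => h hts; apply: lt; right.
apply: open_comp; last exact: open_gt.
by move=> s _; apply: (lin_polyfun cZ (lt _ _)).1; left.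
Qed.

End Symbolic.

(** * Leaves of the computation tree and the cells that they serve *)

Section Leaves.
Variables (R : realType) (k : nat) (P : program R).
Notation V := 'rV[R]_k.
Variables (input : V -> nat -> R) (D : set V).
Hypothesis input_lin : forall a, lin [::] (fun s => input s a).

Definition start (s : V) : config R := Config 0 (fun=> 0) (input s).

Hypothesis no_error : forall s t, D s -> halted P (at_time P t (start s)) \/
  step P (at_time P t (start s)) = Some (at_time P t.+1 (start s)).

Definition sstart : sstate R k :=
  SState 0 (fun _ _ => 0) (fun _ _ => 1) (fun a s => input s a) (fun _ _ => 1) [::].

Lemma on_chain_sstart : on_chain [::] sstart.
Proof.
split=> //=; last exact: lin_cst; first by split; exact: lin_cst.
by split; [exact: input_lin|exact: lin_cst].
Qed.

Lemma agree_sstart s : agree sstart s (start s).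
Proof. by split=> //= i; rewrite ?mul0r ?divr1 oner_neq0. Qed.

(** One bit is consumed per instruction; only nontrivial branches look at it. *)
Let leaf bits := srun P bits sstart.

Lemma leaf_chain bits : exists2 Z, on_chain Z (leaf bits) & (size Z <= 5 * size bits)%N.
Proof. by have [Z oc sZ] := srun_chain P bits on_chain_sstart; exists Z. Qed.

Lemma leaf_open bits : open [set s | followed (leaf bits) s].
Proof. by have [Z oc _] := leaf_chain bits; exact: followed_open oc. Qed.

(** Since no access fails on the open set, the address is a natural number throughout it, and a
    quotient of polynomial functions with this property is constant. *)
Lemma good_address_open Z st (O : set V) (c : V -> config R) : on_chain Z st ->
  open O -> O !=set0 ->
  (forall s, O s -> agree st s (c s) /\ step P (c s) <> None) -> good_address P st.
Proof.
move=> [cZ lr lm _ _] oO O0 H; rewrite /good_address.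
have K i : (forall s, O s -> address (reg (c s) i) <> None) ->
    exists a, constant_address (snum st i) (sden st i) a.
  move=> addr; apply: (polyfun_nat_quotient _ _ oO O0).
  - exact: lin_polyfun cZ (lr i).1.
  - exact: lin_polyfun cZ (lr i).2.
  move=> s Os; have [[_ rP _] _] := H s Os; have [d0 rE] := rP i; split=> //.
  by rewrite -rE; have := addr s Os; rewrite /address; case: ifP.
case E: (scurrent P st) => [i x|i j|i j|i j|o i j h|l'|o i j l'|] //; apply: K => s Os;
  have [[pcE _ _]] := H s Os; rewrite /step; move: pcE; case: (c s) => l r m /= pcE;
  by rewrite /current pcE -/(scurrent P st) E; case: address.
Qed.

(* The open set makes every address used on the path constant. *)
Lemma leaf_agree bits (O : set V) : open O -> O `<=` D ->
  (exists2 s, O s & followed (leaf bits) s) ->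
  forall s, D s -> followed (leaf bits) s ->
    agree (leaf bits) s (at_time P (size bits) (start s)).
Proof.
move=> oO OD; elim/last_ind: bits => [|bits b IH] [s0 Os0 fs0] s Ds fs.
  exact: agree_sstart.
move: fs0 fs; rewrite /leaf srun_rcons => fs0 fs; rewrite size_rcons.
have fs0' := sstep_followed fs0.
have {}IH := IH (ex_intro2 _ _ s0 Os0 fs0').
have ag := IH s Ds (sstep_followed fs).
have haltE s' st c : agree st s' c -> halted P c = if scurrent P st is Halt then true else false.
  by move=> [pcE _ _]; rewrite /halted /current pcE.
have curE : halted P (at_time P (size bits) (start s)) =
            if scurrent P (leaf bits) is Halt then true else false by exact: haltE ag.
have [hlt|stp] := no_error (size bits) Ds.
  rewrite /at_time /= -/(at_time P (size bits) (start s)) /step_or_stay halted_step //=.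
  move: curE; rewrite hlt; move: ag; rewrite /leaf; case: srun => l n d mn md ts ag.
  by rewrite /sstep /=; case: scurrent.
apply: (sstep_agree ag stp) => //.
have [Z oc _] := leaf_chain bits.
apply: (@good_address_open Z _ (O `&` [set s | followed (leaf bits) s])
  (fun s => at_time P (size bits) (start s)) oc).
- apply: openI => //; exact: leaf_open.
- by exists s0.
move=> s' [Os' fs']; have ag' := IH s' (OD _ Os') fs'; split=> //.
have [hlt'|->] := no_error (size bits) (OD _ Os'); last by [].
move: (haltE _ _ _ _ ag'); rewrite hlt' -curE => hlt.
by rewrite halted_step in stp.
Qed.

(** The witness may move inside [O]: a test that is not identically zero is nonzero somewhere on the
    open set of points still followed, and its sign there is the next bit. *)
Lemma leaf_exists t (O : set V) : open O -> O !=set0 ->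
  exists bits, size bits = t /\ exists2 s, O s & followed (leaf bits) s.
Proof.
move=> oO [s0 Os0]; elim: t => [|t [bits [szb [s Os fs]]]].
  by exists [::]; split=> //; exists s0.
have [Z oc _] := leaf_chain bits.
suff [b [s' Os' fs']] : exists b, exists2 s', O s' & followed (sstep P b (leaf bits)) s'.
  exists (rcons bits b); rewrite size_rcons szb; split=> //; exists s' => //.
  by rewrite /leaf srun_rcons.
have oO' : open (O `&` [set s | followed (leaf bits) s]) by apply: openI => //; exact: leaf_open.
move: oO' fs oc; case: (leaf bits) => l n d mn md ts oO' fs oc.
rewrite /sstep; case: scurrent => [i x|i j|i j|i j|o i j h|l'|o i j l'|];
  try by exists true; exists s.
  by exists true; exists s => //; case: o.
case: asboolP => [triv|ntriv]; first by exists true; exists s.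
have [s' [Os' fs'] Fs'] : exists2 s', (O `&` [set s | followed (SState l n d mn md ts) s]) s' &
    diff_test (SState l n d mn md ts) i j s' != 0.
  apply: contra_notP ntriv => H; apply: (polyfun_eq0_open _ oO'); last first.
  - by move=> s' Os'; apply/eqP; apply: contra_notT H => Fs'; exists s'.
  - by exists s.
  have [cZ lr _ _ _] := oc.
  have pr h := lin_polyfun cZ (lr h).1; have pd h := lin_polyfun cZ (lr h).2.
  rewrite /diff_test; apply: polyfunM; last exact: polyfunM.
  apply: polyfunD; first exact: polyfunM.
  under eq_fun do rewrite -mulN1r.
  by apply: polyfunM; [exact: polyfun_cst|exact: polyfunM].
exists (diff_test (SState l n d mn md ts) i j s' < 0); exists s' => // f /= [<-|]; last exact: fs'.
suff : forall x : R, x != 0 -> 0 < (if x < 0 then -1 else 1) * x by exact.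
move=> x; case: (ltgtP x 0) => // x0 _.
  by rewrite mulN1r oppr_gt0.
by rewrite mul1r.
Qed.

Variables (I : finType) (cell ccell : I -> set V) (W : set V) (T : nat) (r : R).
Hypotheses (k_gt0 : (0 < k)%N) (r_ge0 : 0 <= r).
Hypothesis cell_open : forall i, open (cell i).
Hypothesis cell_nonempty : forall i, cell i !=set0.
Hypothesis ccell_compact : forall i, compact (ccell i).
Hypothesis cell_ccell : forall i, cell i `<=` ccell i.
Hypothesis ccellD : forall i, ccell i `<=` D.
Hypothesis ccellW : forall i, ccell i `<=` cell i `|` W.
Hypothesis ccell_box : forall i s c, ccell i s -> `|s 0 c| <= r.
Hypothesis cell_disj : forall i j s, cell i s -> ccell j s -> i = j.
Let out s := reg (at_time P T (start s)) 0.
Hypothesis out_cell : forall i s, cell i s -> out s = 0.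
Hypothesis out_W : forall s, D s -> W s -> out s <> 0.

(** The regions for the component count are the parts of the closed cells where all tests are
    nonnegative. The product of the tests is positive at the sample points and can be positive only
    inside the open cells. *)
Lemma leaf_cells (bits : T.-tuple bool) (N : nat) (h : 'I_N -> I) (s : 'I_N -> V) :
  injective h -> (forall i, cell (h i) (s i)) -> (forall i, followed (leaf bits) (s i)) ->
  (N <= 12 ^ (k + 10 * T))%N.
Proof.
move=> h_inj cs fs; case: (posnP N) => [->//|N_gt0].
have [Z oc sZ] := leaf_chain bits; have [cZ lr _ lt lp] := oc.
have cellD i : cell i `<=` D by move=> y /cell_ccell/ccellD.
(* On a leaf the output is one quotient. Its numerator vanishes on an open set, hence everywhere, so
   a followed point cannot lie on a wall, where the output is nonzero. *)
have fol_cell i y : ccell i y -> followed (leaf bits) y -> cell i y.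
  move=> cy fy; have [//|Wy] := ccellW cy; case: (out_W (ccellD cy) Wy).
  pose i0 := Ordinal N_gt0.
  have ag z : D z -> followed (leaf bits) z -> agree (leaf bits) z (at_time P T (start z)).
    have := @leaf_agree bits (cell (h i0)); rewrite size_tuple; apply => //.
    by exists (s i0).
  have [_ /(_ 0%N)[_ outE] _] := ag _ (ccellD cy) fy.
  rewrite /out outE (_ : snum _ _ _ = 0) ?mul0r //.
  apply: (@polyfun_eq0_open _ _ _ (cell (h i0) `&` [set s | followed (leaf bits) s])).
  - exact: lin_polyfun cZ (lr 0%N).1.
  - by apply: openI => //; exact: leaf_open.
  - by exists (s i0); split; [exact: cs|exact: fs].
  move=> z [cz fz]; have [_ /(_ 0%N)[d0 outE'] _] := ag _ (cellD _ _ cz) fz.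
  have := out_cell cz; rewrite /out outE' => /eqP; rewrite mulf_eq0 invr_eq0 (negPf d0) orbF.
  by move/eqP.
(* The closed counterpart of [followed]: under it, the product of the tests is positive exactly when
   every test is. *)
pose weak y := forall f, List.In f (tests (leaf bits)) -> 0 <= f y.
have prod_gt0 y : weak y -> 0 < test_product (leaf bits) y <-> followed (leaf bits) y.
  rewrite /weak /test_product /followed; elim: (tests _) => [|f ts IH] wk; first by split.
  have fy : 0 <= f y by apply: wk; left.
  have {}IH : 0 < foldr (fun f x => x * f y) 1 ts <-> forall f, List.In f ts -> 0 < f y.
    by apply: IH => g gts; apply: wk; right.
  split=> /= [|H].
    have [<-|] := eqVneq 0 (f y); first by rewrite mulr0 ltxx.
    rewrite eq_sym => f0; have fy0 : 0 < f y by rewrite lt_neqAle eq_sym f0.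
    by rewrite pmulr_lgt0 // => /IH H g [<-|/H].
  apply: mulr_gt0; last by apply: H; left.
  by apply/IH => g gts; apply: H; right.
have fol_weak y : followed (leaf bits) y -> weak y by move=> H f /H /ltW.
have weak_closed : closed [set y | weak y].
  rewrite /weak; move: (tests _) lt => ts; elim: ts => [|f ts IH] lt.
    have -> : [set s | forall f : V -> R, List.In f [::] -> 0 <= f s] = setT.
      by apply/seteqP; split=> // z _ f [].
    exact: closedT.
  have -> : [set s | forall f0 : V -> R, List.In f0 (f :: ts) -> 0 <= f0 s] =
      (f @^-1` [set x | 0 <= x]) `&` [set s | forall f : V -> R, List.In f ts -> 0 <= f s].
    apply/seteqP; split=> z /=.
      by move=> H; split=> [|g gts]; apply: H; [left|right].
    by move=> [fz H] g [<-//|]; exact: H.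
  apply: closedI; last by apply: IH => g gts; apply: lt; right.
  apply: closed_comp; last exact: closed_ge.
  by move=> z _; apply: (lin_polyfun cZ (lt _ _)).1; left.
have := @chain_component_count R k Z (test_product (leaf bits)) N r
  (fun i => ccell (h i) `&` [set y | weak y]) s cZ lp k_gt0 r_ge0.
rewrite size_tuple in sZ.
move=> H; apply: leq_trans (H _ _ _ _ _ _) _.
- by move=> i; apply: compact_closedI => //.
- by move=> i y c [cy _]; exact: ccell_box cy.
- by move=> i; split; [exact: cell_ccell|exact: fol_weak].
- by move=> i; apply/prod_gt0 => //; exact: fol_weak.
- move=> i y [cy wy] /(prod_gt0 _ wy) fy.
  have : nbhs y (cell (h i) `&` [set s | followed (leaf bits) s]).
    apply: open_nbhs_nbhs; split; first by apply: openI => //; exact: leaf_open.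
    by split=> //; exact: fol_cell.
  apply: filterS => z [cz fz]; split; [exact: cell_ccell|exact: fol_weak].
- move=> i j y [ci wy] [cj _] /(prod_gt0 _ wy) fy; apply: h_inj.
  by apply: cell_disj cj; exact: fol_cell.
by rewrite leq_pexp2l //; lia.
Qed.

(** Each cell is assigned a leaf that it meets; there are 2^T leaves, and [leaf_cells] bounds the
    cells assigned to each. *)
Lemma cells_bound : (#|I| <= 2 ^ T * 12 ^ (k + 10 * T))%N.
Proof.
have H i : exists p : T.-tuple bool * V, cell i p.2 /\ followed (leaf p.1) p.2.
  have [bits [szb [s cs fs]]] := leaf_exists T (@cell_open i) (cell_nonempty i).
  by move/eqP: szb => szb; exists (Tuple szb, s).
have [p pP] := choice H.
rewrite -sum1_card (partition_big (fun i => (p i).1) xpredT) //=.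
have -> : (2 ^ T = #|{: T.-tuple bool}|)%N by rewrite card_tuple card_bool.
rewrite -sum_nat_const; apply: leq_sum => bits _.
rewrite sum1_card.
pose K := [pred i | (p i).1 == bits].
apply: (@leaf_cells bits #|K| (fun j => enum_val j) (fun j => (p (enum_val j)).2)).
- exact: enum_val_inj.
- by move=> j; have [] := pP (enum_val j).
by move=> j; have := enum_valP j; rewrite inE => /eqP <-; have [] := pP (enum_val j).
Qed.

End Leaves.

(** * Trees given by a parent function *)

Section ParentTree.
Variables (n : nat) (par : nat -> nat).
Hypothesis par_lt : forall u, (0 < u)%N -> (par u < u)%N.

Definition parent_adj : rel 'I_n := fun u v =>
  ((0 < v) && (par v == u) || (0 < u) && (par u == v))%N.

Lemma parent_adj_sym : symmetric parent_adj.
Proof. by move=> u v; rewrite /parent_adj orbC. Qed.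

Lemma parent_adj_lt u v : parent_adj u v -> (v < u)%N -> v = par u :> nat.
Proof. by move=> /orP[/andP[v0 /eqP <-]|/andP[_ /eqP ->]//]; have := par_lt v0; lia. Qed.

Lemma parent_adj_neq u v : parent_adj u v -> u != v :> nat.
Proof. by move=> /orP[/andP[/par_lt]|/andP[/par_lt]]; lia. Qed.

Lemma parent_tree : (0 < n)%N -> is_tree parent_adj.
Proof.
move=> n_gt0; split=> //; first exact: parent_adj_sym.
- by move=> u; apply: contraTF isT => /parent_adj_neq; rewrite eqxx.
- have to0 : forall u : 'I_n, connect parent_adj u (Ordinal n_gt0).
    move=> u; have [N] := ubnP u; elim: N u => // N IH u uN.
    case: (posnP u) => [u0|u_gt0].
      by rewrite (_ : u = Ordinal n_gt0) ?connect0 //; apply: val_inj.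
    have pn : (par u < n)%N by rewrite (ltn_trans (par_lt u_gt0)).
    apply: connect_trans (IH (Ordinal pn) _); last by have /= := par_lt u_gt0; lia.
    by apply: connect1; rewrite /parent_adj u_gt0 eqxx orbT.
  move=> u v; apply: connect_trans (to0 u) _.
  by rewrite (sym_connect_sym parent_adj_sym).
move=> c /andP[cyc unq]; rewrite leqNgt; apply/negP => c3.
have [x0 x0c] : exists x, x \in c by case: (c) c3 => // x c' _; exists x; rewrite mem_head.
(* Both neighbours of the largest node of the cycle are smaller, so both equal its parent; on a
   cycle with at least three nodes they are distinct. *)
pose x := [arg max_(x > x0 in c) val x].
have [xc xmax] : x \in c /\ forall y, y \in c -> (y <= x)%N.
  by rewrite /x; case: arg_maxnP.
have [i c' cE] := rot_to xc.
have {}cyc : cycle parent_adj (x :: c') by rewrite -cE rot_cycle.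
have {}unq : uniq (x :: c') by rewrite -cE rot_uniq.
have {}xmax y : y \in x :: c' -> (y <= x)%N by rewrite -cE mem_rot; exact: xmax.
have {}c3 : (2 < size (x :: c'))%N by rewrite -cE size_rot.
case: c' cE cyc unq xmax c3 => [|y [|z p]] // _ cyc unq xmax _.
have parx t : t \in [:: x, y, z & p] -> parent_adj x t -> t = par x :> nat.
  move=> tc xt; apply: parent_adj_lt => //.
  by have := xmax t tc; have := parent_adj_neq xt; lia.
have yE : y = par x :> nat.
  by apply: parx; [rewrite !inE eqxx orbT|case/andP: cyc].
have tE : last z p = par x :> nat.
  apply: parx; first by rewrite in_cons in_cons mem_last !orbT.
  by move: cyc; rewrite /= rcons_path => /and4P[_ _ _]; rewrite parent_adj_sym.
move: unq; rewrite /= => /and3P[_ /negP[]].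
by rewrite (_ : y = last z p) ?mem_last //; apply: val_inj; rewrite /= yE tE.
Qed.

(** After ascending from a parent to its child, a simple path cannot descend: the only smaller
    neighbour of the child is the parent just left. *)
Lemma simple_path_up (x y : 'I_n) q : path parent_adj x (y :: q) -> uniq (x :: y :: q) ->
  (x < y)%N -> (x < last y q)%N.
Proof.
elim: q x y => [//|z q IH] x y /= /and3P[xy yz zq] unq lt.
have yz' : (y < z)%N.
  have := parent_adj_neq yz; rewrite neq_ltn => /orP[//|zy].
  have xE := parent_adj_lt (etrans (parent_adj_sym y x) xy) lt.
  have zE := parent_adj_lt yz zy.
  by move: unq; rewrite (_ : x = z) ?inE ?eqxx ?orbT //; apply: val_inj; rewrite /= xE zE.
apply: ltn_trans lt _; apply: IH => //=; first by rewrite yz.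
by move: unq => /andP[_].
Qed.

(** If the last edge descends to the parent of [z], the edge into [z] descends too, as it would
    otherwise come from that same parent; so the whole path descends. *)
Lemma simple_path_down (x y z : 'I_n) q : path parent_adj x (rcons q y) -> last x q = z ->
  uniq (x :: rcons q y) -> (y < z)%N -> (y < x)%N.
Proof.
elim/last_ind: q z y => [|q t IH] z y; first by move=> _ /= ->.
rewrite last_rcons => pth tz unq lt; subst t.
move: (pth); rewrite rcons_path last_rcons => /andP[pq zy].
have pq' := pq; move: pq'; rewrite rcons_path => /andP[_ tz].
have yE := parent_adj_lt zy lt.
have unq' : uniq (x :: rcons q z).
  by move: unq; rewrite -!rcons_cons rcons_uniq => /andP[].
apply: ltn_trans lt _; apply: (IH _ _ pq erefl unq').
have := parent_adj_neq tz; rewrite neq_ltn => /orP[lt'|//].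
have tE := parent_adj_lt (etrans (parent_adj_sym z (last x q)) tz) lt'.
move: unq; rewrite -!rcons_cons rcons_uniq mem_rcons in_cons => /andP[/negP[]].
rewrite (_ : y = last x q) ?mem_last ?orbT //; apply: val_inj; rewrite /= yE -tE //.
Qed.

Variables (R : realType) (D : 'I_n -> 'I_n -> R).
Hypotheses (D_refl : forall u, D u u = 0) (D_sym : forall u v, D u v = D v u).
Hypothesis D_par : forall u v w : 'I_n, (v < u)%N -> w = par u :> nat -> D u v = D u w + D w v.

(** The neighbour on the path of its larger end is the parent of that end, so [D_par] splits off
    this edge. *)
Lemma simple_path_length (p : seq 'I_n) u : path parent_adj u p -> uniq (u :: p) ->
  \sum_(e <- zip (u :: p) p) D e.1 e.2 = D u (last u p).
Proof.
have [N] := ubnP (size p); elim: N p u => // N IH p u pN pth unq.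
case: (ltngtP (last u p) u) => [lt|gt|eq].
- case: p pN pth unq lt => [|y q] //= pN; first by rewrite ltnn.
  move=> /andP[uy pth] unq lt; have yu : (y < u)%N.
    have := parent_adj_neq uy; rewrite neq_ltn => /orP[uy'|//].
    have := @simple_path_up u y q; rewrite /= uy pth => /(_ isT unq uy'); lia.
  rewrite big_cons /= (D_par lt (parent_adj_lt uy yu)) IH //.
  by move: unq => /andP[].
- case/lastP: p pN pth unq gt => [|q y]; first by rewrite ltnn.
  rewrite size_rcons last_rcons => qN pth unq lt.
  move: (pth); rewrite rcons_path => /andP[pq zy].
  have yz : (last u q < y)%N.
    have := parent_adj_neq zy; rewrite neq_ltn => /orP[//|zy'].
    by have := simple_path_down pth erefl unq zy'; lia.
  have unq' : uniq (u :: q) by move: unq; rewrite -rcons_cons rcons_uniq => /andP[].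
  have zipE : zip (u :: rcons q y) (rcons q y) = rcons (zip (u :: q) q) (last u q, y).
    move: (u) => x; clear; elim: q x => [//|z q IH] x /=.
    by rewrite -IH.
  have -> : D u y = D u (last u q) + D (last u q) y.
    rewrite (D_sym u) (@D_par y u (last u q) lt); first by rewrite addrC D_sym (D_sym y).
    by apply: parent_adj_lt => //; rewrite parent_adj_sym.
  by rewrite zipE -cats1 big_cat big_seq1 /= IH.
have -> : p = [::].
  case: p eq unq {pN pth} => // y q /= eq; have {}eq : last y q = u by exact: val_inj.
  by rewrite -eq mem_last.
by rewrite big_nil /= D_refl.
Qed.

Lemma parent_dist (I : instance R n) : adj I =2 parent_adj ->
  (forall u v, adj I u v -> len I u v = D u v) -> forall u v, dist I u v = D u v.
Proof.
move=> adjE lenE u v; rewrite /dist /tree_path.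
have adjF : adj I = parent_adj by apply/funext => x; apply/funext => y; rewrite adjE.
case: pickP => [p /and3P[pth /eqP <- unq]|no].
  rewrite -simple_path_length ?adjF -?(eq_path adjE) //.
  have : forall (q : seq 'I_n) x, path (adj I) x q ->
      \sum_(e <- zip (x :: q) q) len I e.1 e.2 = \sum_(e <- zip (x :: q) q) D e.1 e.2.
    elim=> [|y q IH] x /=; first by rewrite !big_nil.
    by move=> /andP[xy yq]; rewrite !big_cons /= lenE // IH.
  exact.
have [_ _ _ conn _] := adj_tree I.
have /connectP[p pth vE] := conn u v.
case/shortenP: pth vE => p' pth unq _ vE.
have szp : (size p' <= n)%N.
  by move: unq => /= /andP[_ /card_uniqP <-]; rewrite -[X in (_ <= X)%N]card_ord max_card.
by have := no (Bseq szp); rewrite [bseqval _]/= pth -vE eqxx unq.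
Qed.

End ParentTree.

(** * Double brooms *)

(* A double broom: the path 0, ..., m with unit edges; a leaf m + 1 at distance
   rho = 2m from node 0; 2k leaves at node 0, of lengths rho - s_c; 2k leaves at
   node m, of lengths rho + s_c - m.  The path node i covers the leaves of s_c
   at node 0 iff i <= s_c, and those at node m iff s_c <= i. *)
Section Broom.
Variables (R : realType) (m k' : nat).
Hypothesis m_gt0 : (0 < m)%N.
Let k := k'.+1.

Definition broom_size : nat := m.+2 + (k + k + (k + k)).
Let n := broom_size.

Definition broom_parent (u : nat) : nat :=
  if (u <= m)%N then u.-1 else if (u < m.+2 + (k + k))%N then 0 else m.

(** The position of the projection of [u] to the path; [broom_height] is the distance of [u] from
    this projection. *)
Definition broom_pos (u : nat) : R :=
  if (u <= m)%N then u%:R else if (u < m.+2 + (k + k))%N then 0 else m%:R.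

Definition broom_radius : R := m%:R + m%:R.

(** The leaves from [m.+2] on come in four blocks of length [k], two at each end of the path, so
    every parameter governs two leaves at each end. *)
Definition broom_param (s : 'rV[R]_k) (u : nat) : R := s 0 (inord ((u - m.+2) %% k)).

Definition broom_height (s : 'rV[R]_k) (u : nat) : R :=
  if (u <= m)%N then 0 else if u == m.+1 then broom_radius else
  if (u < m.+2 + (k + k))%N then broom_radius - broom_param s u
  else broom_param s u + m%:R.

Definition broom_dist (s : 'rV[R]_k) (u v : 'I_n) : R :=
  if u == v then 0
  else broom_height s u + broom_height s v + `|broom_pos u - broom_pos v|.

Lemma broom_parent_lt u : (0 < u)%N -> (broom_parent u < u)%N.
Proof.
by rewrite /broom_parent => u0; case: (leqP u m) => um; [lia|case: ifP => _; lia].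
Qed.

Lemma broom_dist_refl s u : broom_dist s u u = 0.
Proof. by rewrite /broom_dist eqxx. Qed.

Lemma broom_dist_sym s u v : broom_dist s u v = broom_dist s v u.
Proof.
by rewrite /broom_dist eq_sym distrC [broom_height s u + _]addrC.
Qed.

Lemma broom_dist_parent s (u v w : 'I_n) : (v < u)%N -> w = broom_parent u :> nat ->
  broom_dist s u v = broom_dist s u w + broom_dist s w v.
Proof.
move=> vu wE; have u0 : (0 < u)%N by lia.
have wu : (w < u)%N by rewrite wE; exact: broom_parent_lt.
rewrite {1 2}/broom_dist -!val_eqE /= !gtn_eqF //.
have [um|mu] := leqP u m.
  have wE' : w = u.-1 :> nat by rewrite wE /broom_parent um.
  have wm : (w <= m)%N by lia.
  have vm : (v <= m)%N by lia.
  have -> : broom_dist s w v = w%:R - v%:R.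
    rewrite /broom_dist /broom_height /broom_pos wm vm !add0r.
    case: eqP => [->|_]; first by rewrite subrr.
    by rewrite ger0_norm // subr_ge0 ler_nat; lia.
  rewrite /broom_height /broom_pos um wm vm !add0r.
  rewrite !ger0_norm ?subr_ge0 ?ler_nat ?(ltnW vu) ?(ltnW wu) //.
  by ring.
have hw : broom_height s w = 0.
  rewrite /broom_height wE /broom_parent [(u <= m)%N]leqNgt mu /=.
  by case: (u < _)%N; rewrite ?leq0n ?leqnn.
have pw : broom_pos w = broom_pos u.
  rewrite /broom_pos wE /broom_parent [(u <= m)%N]leqNgt mu /=.
  by case: (u < _)%N; rewrite ?leq0n ?leqnn.
rewrite hw pw subrr normr0 !addr0 /broom_dist; case: eqP => [<-|_].
  by rewrite -pw hw subrr normr0 !addr0.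
by rewrite hw pw add0r addrA.
Qed.

(** The bounds keep the lengths nonnegative; the lower bound 1 also keeps the parameters away from
    node 0, whose penalty is thus always [2 * k]. *)
Definition broom_box (s : 'rV[R]_k) : Prop := forall c, 1 <= s 0 c <= m%:R.

Lemma broom_height_ge0 s u : broom_box s -> 0 <= broom_height s u.
Proof.
move=> box; rewrite /broom_height /broom_radius.
have m0 : 0 <= m%:R :> R by exact: ler0n.
case: ifP => _ //; case: ifP => _; first by lra.
have /andP[c1 c2] := box (inord ((u - m.+2) %% k)).
by rewrite /broom_param; case: ifP => _; lra.
Qed.

Lemma broom_dist_ge0 s u v : broom_box s -> 0 <= broom_dist s u v.
Proof.
by move=> box; rewrite /broom_dist; case: eqP => // _; rewrite !addr_ge0 ?broom_height_ge0.
Qed.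

Definition broom_adj : rel 'I_n := @parent_adj n broom_parent.

Lemma broom_tree : is_tree broom_adj.
Proof. exact: (parent_tree broom_parent_lt). Qed.

Lemma broom_radius_ge0 : 0 <= broom_radius.
Proof. by rewrite addr_ge0 ?ler0n. Qed.

Definition broom (s : 'rV[R]_k) (box : broom_box s) : instance R n :=
  @Instance R n broom_adj (broom_dist s) (fun=> 1) (fun=> broom_radius)
    broom_tree (fun u v _ => broom_dist_sym s u v) (fun u v _ => broom_dist_ge0 u v box)
    (fun=> ler01) (fun=> broom_radius_ge0).

Lemma broom_distE s (box : broom_box s) u v : dist (broom box) u v = broom_dist s u v.
Proof.
apply: (parent_dist broom_parent_lt (D := broom_dist s)) => //.
- exact: broom_dist_refl.
- exact: broom_dist_sym.
- exact: broom_dist_parent.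
Qed.

Definition uncovered s (y u : 'I_n) : bool := broom_radius < broom_dist s u y.

Lemma broom_penalty s (box : broom_box s) y :
  total_penalty (broom box) y = (\sum_(u < n) uncovered s y u)%:R.
Proof.
rewrite /total_penalty natr_sum; apply: eq_bigr => u _.
by rewrite /imposed broom_distE /= /uncovered; case: ltP.
Qed.

Lemma broom_count_split s (y : 'I_n) :
  (\sum_(u < n) uncovered s y u =
   \sum_(u < m.+2) uncovered s y (lshift _ u) +
   (\sum_(c < k) uncovered s y (rshift m.+2 (lshift (k + k) (lshift k c))) +
    \sum_(c < k) uncovered s y (rshift m.+2 (lshift (k + k) (rshift k c))) +
    (\sum_(c < k) uncovered s y (rshift m.+2 (rshift (k + k) (lshift k c))) +
     \sum_(c < k) uncovered s y (rshift m.+2 (rshift (k + k) (rshift k c))))))%N.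
Proof. by rewrite /n /broom_size !big_split_ord. Qed.

Lemma broom_paramE s (c : 'I_k) u : (u - m.+2 = c %[mod k])%N -> broom_param s u = s 0 c.
Proof.
move=> uc; rewrite /broom_param uc modn_small //; congr (s 0 _); exact: inord_val.
Qed.

Lemma uncovered_left s (y u : 'I_n) (c : 'I_k) : (y <= m)%N ->
  (m.+2 <= u < m.+2 + (k + k))%N -> (u - m.+2 = c %[mod k])%N ->
  uncovered s y u = (s 0 c < (y : nat)%:R).
Proof.
move=> ym /andP[um uk] uc; rewrite /uncovered /broom_dist -val_eqE /= gtn_eqF; last lia.
rewrite /broom_height /broom_pos ym uk leqNgt (_ : m < u)%N /=; last lia.
rewrite gtn_eqF; last lia.
rewrite (broom_paramE s uc) sub0r normrN normr_nat.
by apply/idP/idP; lra.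
Qed.

Lemma uncovered_right s (y u : 'I_n) (c : 'I_k) : (y <= m)%N ->
  (m.+2 + (k + k) <= u)%N -> (u - m.+2 = c %[mod k])%N ->
  uncovered s y u = ((y : nat)%:R < s 0 c).
Proof.
move=> ym uk uc; rewrite /uncovered /broom_dist -val_eqE /= gtn_eqF; last lia.
rewrite /broom_height /broom_pos ym [(u < _ + _)%N]ltnNge uk leqNgt (_ : m < u)%N /=; last lia.
rewrite gtn_eqF; last lia.
rewrite (broom_paramE s uc) /broom_radius ger0_norm ?subr_ge0 ?ler_nat //.
by apply/idP/idP; lra.
Qed.

Lemma uncovered_path s (y u : 'I_n) : (y <= m)%N -> (u < m.+2)%N ->
  uncovered s y u = (u == m.+1 :> nat) && (0 < y)%N.
Proof.
move=> ym; rewrite ltnS leq_eqVlt => /orP[/eqP uE|]; last first.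
  rewrite ltnS => um; rewrite (_ : u == m.+1 :> nat = false) /=; last by apply/eqP; lia.
  rewrite /uncovered /broom_dist; case: eqP => _.
    by apply/negbTE; rewrite -leNgt broom_radius_ge0.
  rewrite /broom_height /broom_pos ym um !add0r /broom_radius; apply/negbTE.
  have u1 : (u : nat)%:R <= m%:R :> R by rewrite ler_nat.
  have u2 : (y : nat)%:R <= m%:R :> R by rewrite ler_nat.
  have u3 : 0 <= (u : nat)%:R :> R by exact: ler0n.
  have u4 : 0 <= (y : nat)%:R :> R by exact: ler0n.
  by rewrite -leNgt ler_norml; lra.
rewrite uE eqxx /= /uncovered /broom_dist -val_eqE /= gtn_eqF; last by lia.
rewrite /broom_height /broom_pos ym uE ltnn eqxx ltn_addr // sub0r normrN normr_nat addr0.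
by rewrite ltrDl ltr0n.
Qed.

(** For each parameter the node [y] misses two leaves on one side, or none if [y] equals the
    parameter. Leaf [m.+1] breaks the tie in favour of node 0, and doubling the leaves lets a single
    hit outweigh this. *)
Lemma broom_count_path s (y : 'I_n) : (y <= m)%N ->
  (\sum_(u < n) uncovered s y u + 2 * \sum_(c < k) (s ord0 c == (y : nat)%:R%R) =
   (0 < y) + 2 * k)%N.
Proof.
move=> ym; rewrite broom_count_split big_ord_recr /=.
rewrite big1 => [|u _]; last first.
  by have um := ltn_ord u; rewrite uncovered_path //= ?ltn_eqF // ltnW.
rewrite uncovered_path //= eqxx /= add0n.
have EL (f : 'I_k -> 'I_n) : (forall c, m.+2 <= f c < m.+2 + (k + k))%N ->
    (forall c, f c - m.+2 = c %[mod k])%N ->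
    (\sum_(c < k) uncovered s y (f c) = \sum_(c < k) (s ord0 c < (y : nat)%:R)%R)%N.
  by move=> f1 f2; apply: eq_bigr => c _; rewrite (uncovered_left _ ym (f1 c) (f2 c)).
have ER (f : 'I_k -> 'I_n) : (forall c, m.+2 + (k + k) <= f c)%N ->
    (forall c, f c - m.+2 = c %[mod k])%N ->
    (\sum_(c < k) uncovered s y (f c) = \sum_(c < k) ((y : nat)%:R < s ord0 c)%R)%N.
  by move=> f1 f2; apply: eq_bigr => c _; rewrite (uncovered_right _ ym (f1 c) (f2 c)).
rewrite (EL (fun c => rshift m.+2 (lshift (k + k) (lshift k c)))); first last.
- by move=> c; rewrite /= addKn.
- by move=> c /=; have := ltn_ord c; lia.
rewrite (EL (fun c => rshift m.+2 (lshift (k + k) (rshift k c)))); first last.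
- by move=> c; rewrite /= addKn modnDl.
- by move=> c /=; have := ltn_ord c; lia.
rewrite (ER (fun c => rshift m.+2 (rshift (k + k) (lshift k c)))); first last.
- by move=> c; rewrite /= addKn -addnA !modnDl.
- by move=> c /=; have := ltn_ord c; lia.
rewrite (ER (fun c => rshift m.+2 (rshift (k + k) (rshift k c)))); first last.
- by move=> c; rewrite /= addKn -addnA !modnDl.
- by move=> c /=; have := ltn_ord c; lia.
have tri : (\sum_(c < k) (s ord0 c < (y : nat)%:R)%R + \sum_(c < k) ((y : nat)%:R < s ord0 c)%R +
    \sum_(c < k) (s ord0 c == (y : nat)%:R%R) = k)%N.
  rewrite -!big_split /= -[RHS]card_ord -sum1_card; apply: eq_bigr => c _.
  by case: ltgtP.
rewrite -[in RHS]tri; ring.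
Qed.

Lemma broom_height_gt (s : 'rV[R]_k) (u : 'I_n) : (forall c, 0 < s 0 c < m%:R) -> (m < u)%N ->
  m%:R < broom_height s u.
Proof.
move=> sb mu; rewrite /broom_height [(u <= m)%N]leqNgt mu /= /broom_radius.
have /andP[c1 c2] := sb (inord ((u - m.+2) %% k)).
have m0 : 0 < m%:R :> R by rewrite ltr0n.
by rewrite /broom_param; case: ifP => _; [|case: ifP => _]; lra.
Qed.

(** Any two of the [4 * k + 1] leaves have heights above [m], so they lie more than the radius
    [2 * m] apart. *)
Lemma broom_count_leaf (s : 'rV[R]_k) (y : 'I_n) : (forall c, 0 < s 0 c < m%:R) -> (m < y)%N ->
  (4 * k <= \sum_(u < n) uncovered s y u)%N.
Proof.
move=> sb my.
have H (u : 'I_n) : ((m < u) && (u != y) <= uncovered s y u)%N.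
  case: (boolP (_ && _)) => // /andP[mu uy]; rewrite lt0b /uncovered /broom_dist (negPf uy).
  have := broom_height_gt sb mu; have := broom_height_gt sb my.
  have := normr_ge0 (broom_pos u - broom_pos y); rewrite /broom_radius; lra.
apply: leq_trans (leq_sum _ (fun u _ => H u)).
rewrite -(leq_add2r (y == y)) eqxx /=.
have -> : (\sum_(u < n) ((m < u) && (u != y)) + 1 = \sum_(u < n) (m < u))%N.
  rewrite (bigD1 y) //= eqxx andbF add0n [RHS](bigD1 y) //= my addnC; congr (_ + _)%N.
  by apply: eq_bigr => u ->; rewrite andbT.
rewrite /n /broom_size big_split_ord big_ord_recr /= ltnSn -addnA.
apply: leq_trans (leq_addl _ _).
rewrite (eq_bigr (fun=> 1%N)) => [|u _]; last by rewrite !addSn ltnS -addnS leq_addr.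
by rewrite sum_nat_const card_ord /=; lia.
Qed.

Definition broom_root : 'I_n := @Ordinal n 0 isT.

Lemma broom_count_root s : broom_box s ->
  (\sum_(u < n) uncovered s broom_root u = 2 * k)%N.
Proof.
move=> box; have := broom_count_path s (y := broom_root) (leq0n m).
rewrite [X in (2 * X)%N]big1 => [|c _]; first by rewrite muln0 addn0.
by have /andP[c1 _] := box c; rewrite gt_eqF //=; lra.
Qed.

Lemma broom_generic s (box : broom_box s) (y : 'I_n) :
  (forall c (i : nat), s 0 c != i%:R) -> is_solution (broom box) y -> y = 0%N :> nat.
Proof.
move=> gen /(_ broom_root); rewrite !broom_penalty broom_count_root // ler_nat.
have sb c : 0 < s 0 c < m%:R.
  have /andP[c1 c2] := box c; have cm := gen c m.
  by rewrite (lt_le_trans ltr01 c1) lt_neqAle cm c2.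
case: (leqP y m) => [ym|my] H; last by have := broom_count_leaf sb my; lia.
have := broom_count_path s ym.
by rewrite [X in (2 * X)%N]big1 => [|c _]; [lia|rewrite (negPf (gen c y))].
Qed.

(** Node [i] has penalty at most [2 * k - 1], which beats the [2 * k] of the root. *)
Lemma broom_wall s (box : broom_box s) (c : 'I_k) (i : nat) :
  s 0 c = i%:R -> ~ is_solution (broom box) broom_root.
Proof.
move=> ci; have /andP[] := box c; rewrite ci ler1n ler_nat => i0 im.
have ik : (i < n)%N by rewrite /n /broom_size; lia.
move=> /(_ (Ordinal ik)); rewrite !broom_penalty broom_count_root // ler_nat.
have := broom_count_path s (y := Ordinal ik) im.
by rewrite (bigD1 c) //= ci eqxx i0; lia.
Qed.

End Broom.

(** * The lower bound *)

Section LinearSequences.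
Variables (R : realType) (k : nat).
Notation V := 'rV[R]_k.

(** Since [fs] is independent of [s], the length is fixed as well as the affine form of each
    entry. *)
Definition lin_seq (S : V -> seq R) : Prop := exists fs : seq (V -> R),
  (forall a, lin [::] (nth (fun=> 0) fs a)) /\ forall s, S s = [seq f s | f <- fs].

Lemma lin_seq_nil : lin_seq (fun=> [::]).
Proof. by exists [::]; split=> // a; rewrite nth_nil; exact: lin_cst. Qed.

Lemma lin_seq_cons f S : lin [::] f -> lin_seq S -> lin_seq (fun s => f s :: S s).
Proof.
move=> lf [fs [lfs SE]]; exists (f :: fs); split=> [[|a]|s /=]; last by rewrite SE.
  exact: lf.
exact: lfs.
Qed.

Lemma lin_seq_cat S S' : lin_seq S -> lin_seq S' -> lin_seq (fun s => S s ++ S' s).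
Proof.
move=> [fs [lfs SE]] [fs' [lfs' SE']]; exists (fs ++ fs'); split=> [a|s].
  by rewrite nth_cat; case: ifP.
by rewrite SE SE' map_cat.
Qed.

Lemma lin_seq_flatten (T : Type) (l : seq T) (S : T -> V -> seq R) :
  (forall e, lin_seq (S e)) -> lin_seq (fun s => flatten [seq S e s | e <- l]).
Proof.
move=> lS; elim: l => [|e l IH] /=; first exact: lin_seq_nil.
exact: lin_seq_cat.
Qed.

Lemma lin_seq_map (T : Type) (l : seq T) (x : R) : lin_seq (fun=> [seq x | _ <- l]).
Proof.
elim: l => [|e l IH] /=; first exact: lin_seq_nil.
by apply: lin_seq_cons => //; exact: lin_cst.
Qed.

Lemma lin_seq_nth S a : lin_seq S -> lin [::] (fun s => nth 0 (S s) a).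
Proof.
move=> [fs [lfs SE]]; have := lfs a; congr (lin [::] _); apply/funext => s.
rewrite SE; case: (ltnP a (size fs)) => h; first by rewrite (nth_map (fun=> 0)).
by rewrite !nth_default ?size_map.
Qed.

End LinearSequences.

(** * Correct machines on double brooms *)

Section BroomLowerBound.
Variables (R : realType) (P : program R) (m k' : nat).
Hypothesis m_gt0 : (0 < m)%N.
Let k := k'.+1.
Notation V := 'rV[R]_k.
Let n := broom_size m k'.

Definition broom_edges : seq ('I_n * 'I_n) :=
  enum [pred e : 'I_n * 'I_n | (e.1 < e.2)%N && broom_adj e.1 e.2].

(* The encoding of the broom, also defined when s is outside the box. *)
Definition broom_encode (s : V) : seq R :=
  n%:R :: flatten [seq [:: (val e.1)%:R; (val e.2)%:R; broom_dist s e.1 e.2]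
                  | e : 'I_n * 'I_n <- broom_edges]
       ++ [seq 1 | _ <- enum 'I_n] ++ [seq broom_radius R m | _ <- enum 'I_n].

Lemma broom_dist_lin (u v : 'I_n) : lin [::] (fun s : V => broom_dist s u v).
Proof.
have H (w : nat) : lin [::] (fun s : V => broom_height m s w).
  rewrite /broom_height /broom_param; case: (w <= m)%N; first exact: lin_cst.
  case: (w == m.+1); first exact: lin_cst.
  case: (w < _)%N; last by apply: linD; [exact: lin_coord|exact: lin_cst].
  by apply: linB; [exact: lin_cst|exact: lin_coord].
rewrite /broom_dist; case: (u == v); first exact: lin_cst.
by apply: linD; [exact: linD|exact: lin_cst].
Qed.

Lemma broom_encode_lin a : lin [::] (fun s => nth 0 (broom_encode s) a).
Proof.
apply: lin_seq_nth; apply: lin_seq_cons; first exact: lin_cst.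
apply: lin_seq_cat; last by apply: lin_seq_cat; exact: lin_seq_map.
apply: lin_seq_flatten => e; do 2 (apply: lin_seq_cons; first exact: lin_cst).
by apply: lin_seq_cons; [exact: broom_dist_lin|exact: lin_seq_nil].
Qed.

Variable T : nat.
Hypothesis solves : forall (s : V) (box : broom_box m s),
  exists2 t, (t <= T)%N & solves_in P (broom m_gt0 box) t.

(* The cells are the open unit cubes of the grid whose hyperplanes s_c = i are
   the inputs on which node 0 is not optimal. *)
Lemma broom_cells_bound : (m.-1 ^ k <= 2 ^ T * 12 ^ (k + 10 * T))%N.
Proof.
pose cell (tau : {ffun 'I_k -> 'I_m.-1}) : set V :=
  [set s | forall c, (tau c).+1%:R < s 0 c < (tau c).+2%:R].
pose ccell (tau : {ffun 'I_k -> 'I_m.-1}) : set V :=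
  [set s | forall c, (tau c).+1%:R <= s 0 c <= (tau c).+2%:R].
pose W : set V := [set s | exists c (i : nat), s 0 c = i%:R].
have -> : (m.-1 ^ k = #|{: {ffun 'I_k -> 'I_m.-1}}|)%N by rewrite card_ffun !card_ord.
have ccell_box tau s : ccell tau s -> broom_box m s.
  move=> cs c; have /andP[c1 c2] := cs c; have tm := ltn_ord (tau c).
  apply/andP; split; first by apply: le_trans c1; rewrite ler1n.
  by apply: le_trans c2 _; rewrite ler_nat; lia.
have cell_ccell tau : cell tau `<=` ccell tau.
  by move=> s cs c; have /andP[/ltW -> /ltW ->] := cs c.
have result (s : V) : broom_box m s ->
    (forall t, halted P (at_time P t (start (fun s => nth 0 (broom_encode s)) s)) \/
      step P (at_time P t (start (fun s => nth 0 (broom_encode s)) s)) =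
      Some (at_time P t.+1 (start (fun s => nth 0 (broom_encode s)) s))) /\
    exists box : broom_box m s, exists y : 'I_n,
      reg (at_time P T (start (fun s => nth 0 (broom_encode s)) s)) 0 = (y : nat)%:R /\
      is_solution (broom m_gt0 box) y.
  move=> box; have [t tT [c [y [hlt out sol]]]] := solves box.
  split=> [t'|]; first exact: halts_in_no_error hlt.
  by exists box, y; split=> //; rewrite -out; congr (reg _ _); exact: halts_in_at_time hlt tT.
apply: (@cells_bound R k P (fun s => nth 0 (broom_encode s)) (@broom_box R m k') broom_encode_lin
  _ _ cell ccell W T m%:R) => //.
- by move=> s t box; exact: (result s box).1.
- move=> tau; rewrite openE => s cs.
  apply: (@filter_forall V _ (fun c z => (tau c).+1%:R < z 0 c < (tau c).+2%:R) (nbhs s)) => c.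
  have /andP[c1 c2] := cs c; have cc := @coord_continuous R 1 k 0 c s.
  near=> z; apply/andP; split; near: z.
    by apply: (cvgr_gt _ cc).
  by apply: (cvgr_lt _ cc).
- move=> tau; exists (\row_c ((tau c).+1%:R + 2^-1)) => c; rewrite mxE.
  by rewrite -[in X in _ && X]natr1; apply/andP; split; lra.
- move=> tau; rewrite (_ : ccell tau =
     [set s : V | forall c, `[(tau c).+1%:R, (tau c).+2%:R]%classic (s ord0 c)]).
    apply: (@rV_compact R k (fun c => `[(tau c).+1%:R, (tau c).+2%:R]%classic)) => c.
    exact: segment_compact.
  by apply/seteqP; split=> s cs c; have := cs c; rewrite /= in_itv.
- move=> tau s cs; case: (pselect (W s)) => [?|nW]; [by right|left] => c.
  have /andP[c1 c2] := cs c; rewrite !lt_neqAle c1 c2 !andbT; apply/andP; split.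
    by apply/eqP => e; apply: nW; exists c, (tau c).+1.
  by apply/eqP => e; apply: nW; exists c, (tau c).+2.
- move=> tau s c /ccell_box/(_ c)/andP[c1 c2].
  by rewrite ger0_norm // (le_trans ler01).
- move=> tau tau' s cs cs'; apply/ffunP => c; apply/val_inj.
  have /andP[c1 c2] := cs c; have /andP[c3 c4] := cs' c.
  have := lt_le_trans c1 c4; have := le_lt_trans c3 c2; rewrite !ltr_nat /=; lia.
- move=> tau s cs; have [_ [box [y [-> sol]]]] := result s (ccell_box _ _ (cell_ccell _ _ cs)).
  rewrite (broom_generic _ sol) // => c i; have /andP[c1 c2] := cs c.
  by apply/eqP => e; move: c1 c2; rewrite e !ltr_nat; lia.
- move=> s sbox [c [i ci]]; have [_ [box [y [-> sol]]]] := result s sbox.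
  move=> /eqP; rewrite pnatr_eq0 => /eqP y0; apply: (broom_wall (box := box) ci).
  by rewrite (_ : broom_root _ _ = y) //; apply: val_inj.
Unshelve. all: by end_near.
Qed.

End BroomLowerBound.

Theorem theorem4 (R : realType) (P : program R)
  (P_correct : forall (n : nat) (I : instance R n),
     unit_penalties I -> equal_radii I -> exists t : nat, solves_in P I t) :
  exists (c : R) (n0 : nat),
    0 < c /\
    forall n : nat, (n0 <= n)%N ->
      exists (I : instance R n) (t : nat),
        [/\ unit_penalties I, equal_radii I, solves_in P I t
          & c * (n%:R * ln n%:R) <= t%:R].
Proof.
(* 2624 is 41 * 64, where 41 is the coefficient of T in the exponent of the final bound; the
   threshold ensures ln n > 65. *)
exists (1 / 2624), ((Num.truncn (expR 65 : R)).+1 + 64)%N; split; first by lra.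
move=> n n0n; apply: contrapT => H.
have n_ge64 : (64 <= n)%N by lia.
have ln_gt65 : 65 < ln (n%:R : R).
  rewrite -ltr_expR lnK ?posrE ?ltr0n; last by lia.
  apply: lt_le_trans (truncnS_gt _) _; rewrite ler_nat.
  exact: leq_trans (leq_addr _ _) n0n.
set x := 1 / 2624 * (n%:R * ln n%:R) in H.
have n_ge0 : 0 < n%:R :> R by rewrite ltr0n; lia.
have x_ge0 : 0 <= x by rewrite /x !mulr_ge0 //; lra.
(* With n/8 parameters the path has length about n/2, and n <= (m - 1)^2 makes ln (m - 1) at least
   half of ln n. *)
have [m [k' [nE m_gt0 mn kn]]] : exists m k', [/\ n = broom_size m k',
    (0 < m)%N, (n <= m.-1 ^ 2)%N & (n <= 16 * k'.+1 <= 4 * n)%N].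
  exists (n - 2 - 4 * (n %/ 8))%N, (n %/ 8).-1; rewrite /broom_size.
  split; [lia|lia|nia|lia].
rewrite nE in H; set T := Num.truncn x.
have bound : (m.-1 ^ k'.+1 <= 2 ^ T * 12 ^ (k'.+1 + 10 * T))%N.
  apply: (@broom_cells_bound R P m k' m_gt0) => s box.
  have [t tP] := P_correct _ (broom m_gt0 box) (fun=> erefl) (fun _ _ => erefl).
  exists t => //; rewrite /T truncn_ge_nat // leNgt; apply/negP => xt; apply: H.
  by exists (broom m_gt0 box), t; split=> //; exact: ltW.
(* 12 is replaced by 2^4. *)
have {}bound : (m.-1 ^ k'.+1 <= 2 ^ (T + 4 * (k'.+1 + 10 * T)))%N.
  apply: leq_trans bound _; rewrite [(2 ^ (T + _))%N]expnD leq_mul // expnM.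
  by rewrite leq_exp2r.
have m1 : (0 < m.-1)%N by case: (m.-1) mn => //; lia.
have lnm : ln (n%:R : R) <= 2 * ln (m.-1%:R : R).
  rewrite mulr_natl -lnXn ?ltr0n // -natrX ler_ln ?posrE ?ltr0n ?expn_gt0 ?m1 ?ler_nat //.
  by lia.
have ln2 : ln (2 : R) <= 1 by have := @le_ln1Dx R 1; apply; lra.
have lnb : k'.+1%:R * ln (m.-1%:R : R) <= (T + 4 * (k'.+1 + 10 * T))%:R.
  apply: le_trans (_ : (T + 4 * (k'.+1 + 10 * T))%:R * ln (2 : R) <= _); last first.
    by rewrite ler_piMr.
  rewrite !mulr_natl -!lnXn ?ltr0n // -!natrX ler_ln ?posrE ?ltr0n ?expn_gt0 ?m1 //.
  by rewrite ler_nat.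
have Tx : T%:R <= x by rewrite truncn_le.
have kn1 : n%:R <= 16 * k'.+1%:R :> R by rewrite -natrM ler_nat; lia.
have kn2 : 4 * k'.+1%:R <= n%:R :> R by rewrite -natrM ler_nat; lia.
move: lnb; rewrite natrD natrM natrD natrM => lnb.
have kl : n%:R / 16 * (ln (n%:R : R) / 2) <= k'.+1%:R * ln (m.-1%:R : R).
  by apply: ler_pM; lra.
have nl : n%:R * 65 <= n%:R * ln (n%:R : R) by rewrite ler_wpM2l // ltW.
(* Now n ln n / 32 <= 41 T + 4 k <= n ln n / 64 + n forces ln n <= 64, a contradiction. *)
move: Tx kl; rewrite /x mulf_div; lra.
Qed.
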